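(* Let $I$ be an infinite set and, for each $i\in I$, let $A_i$ be a non-zero unital $C^*$-algebra with state space $S(A_i)$. The $^*$-representation $\Psi_A:=\bigoplus_{\rho\in\prod_{i\in I}S(A_i)}(H_{\check\rho},\pi_{\check\rho})$ of $\bigotimes^{\rm ut}_{i\in I}A_i$ is injective. Consequently, the $^*$-representation $$\Phi_A:=\bigoplus_{\rho\in\prod_{i\in I}S(A_i)}\Big(\bar\bigotimes^{\phi_1}_{i\in I}H_{\rho_i},\ \bigotimes^{\phi_1}_{i\in I}\pi_{\rho_i}\Big)$$ of $\bigotimes^{\rm ut}_{i\in I}A_i$ is also injective.
   Context: $\bigotimes_{i\in I}X_i$ is the vector space with a multilinear (linear in each variable separately) map $\Theta_X:x\mapsto\otimes_{i\in I}x_i$ from $\prod_{i\in I}X_i$ through which every multilinear map on $\prod_{i\in I}X_i$ factors via a unique linear map. For $x,y\in\prod_{i\in I}(X_i\setminus\{0\})$, $x\sim y$ means $x_i=y_i$ for all but finitely many $i$; for $\omega=[u]_\sim$, $\bigotimes^\omega_{i\in I}X_i=\mathrm{span}\{\otimes_{i\in I}x_i:x_i=u_i\text{ for all but finitely many }i\}$. $\bigotimes_{i\in I}A_i$ is a $^*$-algebra with coordinatewise operations on elementary tensors. With $U_{A_i}$ the unitary group of $A_i$ and $\Omega^{\rm ut}_{I;A}=\prod_{i\in I}U_{A_i}/\sim$, $\bigotimes^{\rm ut}_{i\in I}A_i=\bigoplus_{\omega\in\Omega^{\rm ut}_{I;A}}\bigotimes^\omega_{i\in I}A_i$, a unital $^*$-subalgebra.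 For Hilbert spaces $H_i\neq0$ with unit spheres $\mathfrak S_1(H_i)$, $\bigotimes^{\rm un}_{i\in I}H_i=\mathrm{span}\,\Theta_H(\prod_{i\in I}\mathfrak S_1(H_i))$ carries the inner product given, for $x,y\in\prod_{i\in I}\mathfrak S_1(H_i)$, by $\langle\otimes x_i,\otimes y_i\rangle_{\phi_1}=\prod_{i\in I}\langle x_i,y_i\rangle$ if $\langle x_i,y_i\rangle=1$ for all but finitely many $i$, and $0$ otherwise; $\bar\bigotimes^{\phi_1}_{i\in I}H_i$ is its completion. For unital $^*$-representations $\pi_i:A_i\to\mathcal L(H_i)$, $\bigotimes^{\phi_1}_{i\in I}\pi_i:\bigotimes^{\rm ut}_{i\in I}A_i\to\mathcal L(\bar\bigotimes^{\phi_1}_{i\in I}H_i)$ is the unital $^*$-representation determined by $(\bigotimes^{\phi_1}_{i\in I}\pi_i)(\otimes a_i)(\otimes x_i)=\otimes\pi_i(a_i)x_i$ for $\otimes a_i\in\bigotimes^{\rm ut}_{i\in I}A_i$ and $\otimes x_i\in\bigotimes^{\rm un}_{i\in I}H_i$. For a state $\tau$ on a $C^*$-algebra, $(H_\tau,\pi_\tau,\xi_\tau)$ is its GNS construction. For $\rho\in\prod_{i\in I}S(A_i)$, $H_{\check\rho}$ is the closure of $\big(\bigotimes^{\phi_1}_{i\in I}\pi_{\rho_i}\big)\big(\bigotimes^{\rm ut}_{i\in I}A_i\big)(\otimes_{i\in I}\xi_{\rho_i})$ in $\bar\bigotimes^{\phi_1}_{i\in I}H_{\rho_i}$, and $\pi_{\check\rho}(a)=\big(\bigotimes^{\phi_1}_{i\in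 I}\pi_{\rho_i}\big)(a)\big|_{H_{\check\rho}}$. *)

(* Defs.v *)
From HB Require Import structures.
From mathcomp Require Import all_boot all_order all_algebra.
From mathcomp Require Import complex.
From mathcomp Require Import all_classical all_reals all_analysis.

Set Implicit Arguments.
Unset Strict Implicit.
Unset Printing Implicit Defensive.

Import Order.TTheory GRing.Theory Num.Theory.
Import numFieldNormedType.Exports.

Local Open Scope classical_set_scope.
Local Open Scope ring_scope.
Local Open Scope complex_scope.

(* Algebras over R[i] are nzRingType's, hence unital with 1 != 0. *)
HB.mixin Record isStarAlgebra (R : realType) A of GRing.Algebra R[i] A := {
  star : A -> A;
  starK : involutive star;
  starP : forall (c : R[i]) (a b : A),
    star (c *: a + b) = Num.conj c *: star a + star b;
  starM : forall a b : A, star (a * b) = star b * star a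
}.

#[short(type="starAlgType")]
HB.structure Definition StarAlgebra (R : realType) :=
  {A of GRing.Algebra R[i] A & isStarAlgebra R A}.

(* The library's normed modules cannot be joined with its non-commutative
   rings, so the complete norm is given explicitly. *)
HB.mixin Record isCStarAlgebra (R : realType) A of StarAlgebra R A := {
  cnorm : A -> R;
  cnorm_eq0 : forall a, cnorm a = 0 -> a = 0;
  cnormD : forall a b, cnorm (a + b) <= cnorm a + cnorm b;
  cnormZ : forall (c : R[i]) a, (cnorm (c *: a))%:C = `|c| * (cnorm a)%:C;
  cnormM : forall a b, cnorm (a * b) <= cnorm a * cnorm b;
  cnorm_starM : forall a, cnorm (star a * a) = cnorm a ^+ 2;
  cnorm_complete : forall u : nat -> A,
    (forall e : R, 0 < e -> exists N, forall m n, (N <= m)%N -> (N <= n)%N ->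
       cnorm (u m - u n) < e) ->
    exists l, (fun n => cnorm (u n - l)) @ \oo --> (0 : R)
}.

#[short(type="cstarAlgType")]
HB.structure Definition CStarAlgebra (R : realType) :=
  {A of StarAlgebra R A & isCStarAlgebra R A}.

(* The inner product is linear in the first variable. *)
HB.mixin Record isHilbert (R : realType) H of CompleteNormedModule R[i] H := {
  inner : {dot H for @Num.conj R[i]};
  inner_norm : forall x : H, `|x| ^+ 2 = inner x x
}.

#[short(type="hilbertType")]
HB.structure Definition Hilbert (R : realType) :=
  {H of CompleteNormedModule R[i] H & isHilbert R H}.

Section LinearSpan.
Context {R : realType} {V : lmodType R[i]}.

Definition lspan (E : set V) : set V :=
  [set v | exists n (c : 'I_n -> R[i]) (x : 'I_n -> V),
     (forall k, E (x k)) /\ v = \sum_(k < n) c k *: x k].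

End LinearSpan.

(* A *-representation by bounded operators of the unital *-subalgebra D of B;
   the values of rho outside D are irrelevant. *)
Definition star_rep (R : realType) (B : starAlgType R) (D : set B)
    (H : hilbertType R) (rho : B -> H -> H) : Prop :=
  [/\ forall a, D a -> linear (rho a) /\ continuous (rho a),
      forall (c : R[i]) a b x, D a -> D b ->
        rho (c *: a + b) x = c *: rho a x + rho b x,
      forall a b x, D a -> D b -> rho (a * b) x = rho a (rho b x),
      forall x, rho 1 x = x
    & forall a x y, D a -> inner (rho a x) y = inner x (rho (star a) y)].

Definition unitary (R : realType) (A : starAlgType R) : set A :=
  [set u | star u * u = 1 /\ u * star u = 1].

Record state (R : realType) (A : cstarAlgType R) := State {
  state_fun :> {scalar A};
  state_ge0 : forall a : A, 0 <= state_fun (star a * a);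
  state1 : state_fun 1 = 1
}.

(* The GNS construction, up to unitary equivalence: [gns_class] exhibits
   [gns_space] as the completion of A / {a | tau (a^* a) = 0} for the inner
   product <[a], [b]> = tau (b^* a), with A acting by left multiplication and
   cyclic vector [1]. *)
Record gnsTriple (R : realType) (A : cstarAlgType R) (tau : state A) :=
  GnsTriple {
  gns_space : hilbertType R;
  gns_rep : A -> gns_space -> gns_space;
  gns_vec : gns_space;
  gns_class : {linear A -> gns_space};
  gns_inner : forall a b, inner (gns_class a) (gns_class b) = tau (star b * a);
  gns_dense : closure (range gns_class) = [set: gns_space];
  gns_star_rep : star_rep [set: A] gns_rep;
  gns_repE : forall a b, gns_rep a (gns_class b) = gns_class (a * b);
  gns_vecE : gns_vec = gns_class 1
}.

Section Tensor.
Context {R : realType} {I : choiceType}.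

Definition multilinear (X : I -> lmodType R[i]) (W : lmodType R[i])
    (f : (forall i, X i) -> W) : Prop :=
  forall (x : forall i, X i) (i : I), linear (fun y : X i => f (dfwith x i y)).

Definition is_tensor (X : I -> lmodType R[i]) (T : lmodType R[i])
    (theta : (forall i, X i) -> T) : Prop :=
  multilinear theta /\
  forall (W : lmodType R[i]) (f : (forall i, X i) -> W), multilinear f ->
    exists! g : T -> W, linear g /\ forall x, g (theta x) = f x.

Record tensorSpace (X : I -> lmodType R[i]) := TensorSpace {
  tspace :> lmodType R[i];
  tmap : (forall i, X i) -> tspace;
  tmapP : is_tensor tmap
}.

Record tensorAlgebra (A : I -> starAlgType R) := TensorAlgebra {
  talg :> starAlgType R;
  tamap : (forall i, A i) -> talg;
  tamapP : @is_tensor (fun i => A i : lmodType R[i]) talg tamap;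
  tamap1 : tamap (fun=> 1) = 1;
  tamapM : forall a b, tamap a * tamap b = tamap (fun i => a i * b i);
  tamap_star : forall a, star (tamap a) = tamap (fun i => star (a i))
}.

Definition cofin_eq (X : I -> Type) (x y : forall i, X i) : Prop :=
  finite_set [set i | x i <> y i].

Definition tensor_class (X : I -> Type) (T : lmodType R[i])
    (theta : (forall i, X i) -> T) (u : forall i, X i) : set T :=
  lspan [set theta x | x in [set x | cofin_eq x u]].

(* The sum of the subspaces attached to the classes of the families of
   unitaries; distinct classes have independent subspaces, so the sum is
   automatically direct. *)
Definition tensor_ut (A : I -> starAlgType R) (T : tensorAlgebra A) : set T :=
  lspan (\bigcup_(u in [set u | forall i, unitary (u i)])
    tensor_class (@tamap A T) u).

Definition sphere_family (H : I -> hilbertType R) : set (forall i, H i) :=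
  [set x | forall i, `|x i| = 1].

Definition tensor_un (H : I -> hilbertType R)
    (T : tensorSpace (fun i => H i : lmodType R[i])) : set T :=
  lspan [set tmap T x | x in @sphere_family H].

(* In the first case the product has only finitely many factors different
   from 1, which is what the finitely supported iterated product computes. *)
Definition phi1_inner (H : I -> hilbertType R) (x y : forall i, H i) : R[i] :=
  if `[< finite_set [set i | inner (x i) (y i) <> 1] >]
  then \big[*%R/1]_(i \in [set: I]) inner (x i) (y i)
  else 0.

(* The completion of [tensor_un]: the form <.,.>_{phi_1} on [tensor_un] is the
   sesquilinear extension of [phi1_inner], i.e. the pull-back of [inner] along
   [phi1_emb], whose values outside [tensor_un] are irrelevant. *)
Record phi1Tensor (H : I -> hilbertType R) := Phi1Tensor {
  phi1_tensor : tensorSpace (fun i => H i : lmodType R[i]);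
  phi1_space :> hilbertType R;
  phi1_emb : phi1_tensor -> phi1_space;
  phi1_emb_linear : forall (c : R[i]) s t, tensor_un s -> tensor_un t ->
    phi1_emb (c *: s + t) = c *: phi1_emb s + phi1_emb t;
  phi1_emb_inner : forall x y, sphere_family x -> sphere_family y ->
    inner (phi1_emb (tmap phi1_tensor x)) (phi1_emb (tmap phi1_tensor y))
    = phi1_inner x y;
  phi1_emb_dense :
    closure (phi1_emb @` @tensor_un H phi1_tensor) = [set: phi1_space]
}.

Definition phi1_elem (H : I -> hilbertType R) (K : phi1Tensor H)
    (x : forall i, H i) : K := phi1_emb (tmap (phi1_tensor K) x).

Definition is_phi1_rep (A : I -> starAlgType R) (T : tensorAlgebra A)
    (H : I -> hilbertType R) (K : phi1Tensor H)
    (rho : forall i, A i -> H i -> H i) (Rho : T -> K -> K) : Prop :=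
  star_rep (@tensor_ut A T) Rho /\
  forall (a : forall i, A i) (x : forall i, H i),
    tensor_ut (tamap T a) -> tensor_un (tmap (phi1_tensor K) x) ->
    Rho (tamap T a) (phi1_elem K x) = phi1_elem K (fun i => rho i (a i) (x i)).

Definition orbit_closure (B : lmodType R[i]) (D : set B) (H : hilbertType R)
    (rho : B -> H -> H) (xi : H) : set H :=
  closure [set rho a xi | a in D].

End Tensor.

Section DirectSum.
Context {R : realType} {P : Type} (H : P -> hilbertType R).

(* The Hilbert space direct sum of the closed subspaces M p of the H p. *)
Definition l2sum (M : forall p, set (H p)) : set (forall p, H p) :=
  [set x | (forall p, M p (x p)) /\
    (\esum_(p in [set: {classic P}])
       (complex.Re (inner (x p) (x p)))%:E < +oo)%E].

(* The direct sum of the restrictions of rho p to M p: each a acts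
   coordinatewise on the elements of the direct sum. When the family
   of the operators rho p a is uniformly bounded, the values lie
   again in [l2sum M]; they are taken here in the ambient product. *)
Definition dsum_rep (B : Type) (M : forall p, set (H p))
    (rho : forall p, B -> H p -> H p) (a : B) :
    {x : forall p, H p | l2sum M x} -> (forall p, H p) :=
  fun x p => rho p a (sval x p).

End DirectSum.

(* Main.v *)
(* The states of a unital C*-algebra separate its points: by Kelley-Vaught,
   a^* a is positive, so that the least t such that t - Re a is positive is
   a sublinear functional of a, and by Hahn-Banach it is attained at any given
   point by the real part of a state.
   Let x = sum_k c_k (tensor a_k), where a_k agrees with a family u_k of
   unitaries up to finitely many indices, be annihilated by every pi_rho on the
   vector xi_rho, and fix v := u_l. Outside a finite set F of indices, choose
   rho_i such that rho_i(v_i^* u_{k,i}) <> 1 for all k with u_{k,i} <> v_i.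
   Then pairing pi_rho(x) xi_rho with the tensor of the vectors pi(v_i) xi_i
   kills the terms with u_k not equivalent to v, and leaves
   sum_{k : u_k ~ v} c_k prod_{i in F} rho_i(v_i^* a_{k,i}) = 0,
   where the rho_i, i in F, are arbitrary. As states separate points, the
   component of x in the class of v is 0. *)
Require Import Defs.
From HB Require Import structures.
From mathcomp Require Import all_boot all_order all_algebra.
From mathcomp Require Import complex.
From mathcomp Require Import all_classical all_reals all_analysis.
From mathcomp Require Import ring lra.

Set Implicit Arguments.
Unset Strict Implicit.
Unset Printing Implicit Defensive.

Import Order.TTheory GRing.Theory Num.Theory.
Import numFieldNormedType.Exports.

Local Open Scope classical_set_scope.
Local Open Scope ring_scope.
Local Open Scope complex_scope.

(** * Hahn-Banach *)

Section HahnBanach.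
Context {R : realType} {V : lmodType R[i]}.
Implicit Types (p q : V -> R) (x y : V).

Definition sublinear p : Prop :=
  (forall x y, p (x + y) <= p x + p y) /\
  (forall (s : R) x, 0 <= s -> p (s%:C *: x) = s * p x).

Lemma sublinear0 p : sublinear p -> p 0 = 0.
Proof. by case=> _ /(_ 0 0 (lexx _)); rewrite scaler0 mul0r. Qed.

Lemma sublinear_geN p x : sublinear p -> - p (- x) <= p x.
Proof.
move=> sp; rewrite lerNl -subr_ge0 opprK addrC.
by rewrite -(sublinear0 sp) -(subrr x) sp.1.
Qed.

(** Shared by the three infima used later: [shift_inf], the infimum of a chain, and [csup]. For
    [r > 0] one inequality of homogeneity suffices, since applying it to [r^-1] gives the other; the
    conditions on [E 0] settle [r = 0]. *)
Lemma sublinear_inf (E : V -> set R) :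
  (forall x, E x !=set0) -> (forall x, has_lbound (E x)) ->
  (forall x y s t, E x s -> E y t -> exists2 u, E (x + y) u & u <= s + t) ->
  (forall (r : R) x s, 0 < r -> E x s ->
    exists2 u, E (r%:C *: x) u & u <= r * s) ->
  (exists2 u, E 0 u & u <= 0) -> (forall s, E 0 s -> 0 <= s) ->
  sublinear (fun x => inf (E x)).
Proof.
move=> En0 Elb ED EZ [u Eu0 u0] E0.
have infle x s : E x s -> inf (E x) <= s by move=> Es; exact: ge_inf.
have leinf x a : (forall s, E x s -> a <= s) -> a <= inf (E x).
  by move=> h; apply: lb_le_inf => // s; exact: h.
have infZ r x : 0 < r -> inf (E (r%:C *: x)) <= r * inf (E x).
  move=> r0; rewrite -ler_pdivrMl//; apply: (leinf) => s Es.
  rewrite ler_pdivrMl//; have [v Ev /(le_trans _)] := EZ _ _ _ r0 Es.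
  by apply; exact: infle.
split=> [x y|r x].
  rewrite -lerBlDr; apply: (leinf) => s Es; rewrite lerBlDr -lerBlDl.
  apply: (leinf) => t Et; rewrite lerBlDl.
  have [v Ev /(le_trans _)] := ED _ _ _ _ Es Et.
  by apply; exact: infle.
rewrite le_eqVlt => /predU1P[<-|r0].
  rewrite mul0r scale0r; apply/eqP; rewrite eq_le leinf// andbT.
  exact: le_trans (infle _ _ Eu0) u0.
apply/eqP; rewrite eq_le infZ//= -ler_pdivlMl//.
apply: le_trans (infZ _ _ _); last by rewrite invr_gt0.
by rewrite scalerA -rmorphM/= mulVf ?gt_eqF// scale1r.
Qed.

(** The usual lowering of [q] along [y]: taking [s = 0] keeps it below [q], and taking [s = 1] at
    [- y] makes its value there at most [- q y]. *)
Definition shift_inf q y : V -> R :=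
  fun x => inf [set q (x + s%:C *: y) - s * q y | s in [set s : R | 0 <= s]].

Lemma shift_inf_lbound q y x s : sublinear q -> 0 <= s ->
  - q (- x) <= q (x + s%:C *: y) - s * q y.
Proof.
move=> sq s0; rewrite lerBrDr addrC lerBlDr -sq.2//.
by apply: le_trans (sq.1 _ _); rewrite addrAC subrr add0r.
Qed.

Lemma shift_inf_le q y x s : sublinear q -> 0 <= s ->
  shift_inf q y x <= q (x + s%:C *: y) - s * q y.
Proof.
move=> sq s0; apply: ge_inf; last by exists s.
by exists (- q (- x)) => _ [t t0 <-]; exact: shift_inf_lbound.
Qed.

Lemma sublinear_shift_inf q y : sublinear q -> sublinear (shift_inf q y).
Proof.
move=> sq; apply: sublinear_inf.
- by move=> x; exists (q (x + 0%:C *: y) - 0 * q y), 0 => /=.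
- by move=> x; exists (- q (- x)) => _ [t t0 <-]; exact: shift_inf_lbound.
- move=> x z _ _ [s /= s0 <-] [t /= t0 <-].
  exists (q (x + z + (s + t)%:C *: y) - (s + t) * q y).
    by exists (s + t) => //=; rewrite addr_ge0.
  rewrite rmorphD scalerDl/= addrACA.
  by rewrite mulrDl opprD [leRHS]addrACA lerD2r; exact: sq.1.
- move=> r x _ r0 [s /= s0 <-].
  exists (q (r%:C *: x + (r * s)%:C *: y) - (r * s) * q y).
    by exists (r * s) => //=; rewrite mulr_ge0// ltW.
  rewrite rmorphM/= -scalerA -scalerDr sq.2; last exact: ltW.
  by rewrite mulrBr mulrA.
- exists (q (0 + 0%:C *: y) - 0 * q y); first by exists 0 => /=.
  by rewrite scale0r addr0 sublinear0// mul0r subr0.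
- move=> _ [s /= s0 <-]; have := @shift_inf_lbound q y 0 s sq s0.
  by rewrite oppr0 sublinear0// oppr0.
Qed.

(** Zorn's lemma. The pointwise infimum of a chain is finite because every sublinear functional
    below [p] is at least [- p (- x)] at [x], and it is subadditive because any two members of the
    chain are comparable. *)
Lemma exists_minimal_sublinear p : sublinear p ->
  exists q, [/\ sublinear q, forall x, q x <= p x &
    forall q', sublinear q' -> (forall x, q' x <= q x) ->
      forall x, q x <= q' x].
Proof.
move=> sp; pose T := {q : V -> R | sublinear q /\ forall x, q x <= p x}.
(* The order is reversed, so that a maximal element is a minimal functional. *)
pose r (a b : T) := `[< forall x, sval b x <= sval a x >].
have [||F Ftot|[q [sq qp]] qmin] :=
  @ZL_preorder T (exist _ p (conj sp (fun x => lexx _))) r.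
- by move=> a; apply/asboolP.
- move=> b a c /asboolP ab /asboolP bc; apply/asboolP => x.
  exact: le_trans (bc x) (ab x).
- have [[a0 Fa0]|F0] := pselect (F !=set0); last first.
    exists (exist _ p (conj sp (fun x => lexx _))) => s Fs.
    by exfalso; apply: F0; exists s.
  pose E x := [set sval a x | a in F].
  have lbE x : lbound (E x) (- p (- x)).
    move=> _ [[a [sa ap]] Fa <-] /=.
    by apply: le_trans (sublinear_geN _ sa); rewrite lerN2.
  have hlE x : has_lbound (E x) by exists (- p (- x)).
  have sE : sublinear (fun x => inf (E x)).
    apply: sublinear_inf => //.
    + by move=> x; exists (sval a0 x), a0.
    + move=> x y _ _ [a Fa <-] [b Fb <-].
      case: (Ftot _ _ Fa Fb) => /asboolP ab.
        exists (sval b (x + y)); first by exists b.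
        by apply: le_trans ((svalP b).1.1 x y) _; rewrite lerD2r.
      exists (sval a (x + y)); first by exists a.
      by apply: le_trans ((svalP a).1.1 x y) _; rewrite lerD2l.
    + move=> s x _ s0 [a Fa <-]; exists (sval a (s%:C *: x)); first by exists a.
      by rewrite (svalP a).1.2// ltW.
    + exists (sval a0 0); first by exists a0.
      by rewrite (sublinear0 (svalP a0).1).
    + by move=> _ [a Fa <-]; rewrite (sublinear0 (svalP a).1).
  have infp x : inf (E x) <= p x.
    apply: le_trans ((svalP a0).2 x); apply: ge_inf => //.
    by exists a0.
  exists (exist _ (fun x => inf (E x)) (conj sE infp)) => a Fa.
  by apply/asboolP => x /=; apply: ge_inf => //; exists a.
- exists q; split=> // q' sq' q'q.
  have q'p x : q' x <= p x by exact: le_trans (q'q x) (qp x).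
  have /asboolP := qmin (exist _ q' (conj sq' q'p)) (introT (asboolP _) q'q).
  exact.
Qed.

(** Minimality applied to [shift_inf q y] gives [q x <= shift_inf q y x], and [s = 1] bounds the
    latter by [q (x + y) - q y]. *)
Lemma minimal_sublinearD q : sublinear q ->
  (forall q', sublinear q' -> (forall x, q' x <= q x) ->
    forall x, q x <= q' x) ->
  forall x y, q (x + y) = q x + q y.
Proof.
move=> sq qmin x y; apply/eqP; rewrite eq_le sq.1/=.
have le1 := @shift_inf_le q y x 1 sq ler01.
rewrite rmorph1 scale1r mul1r lerBrDr in le1; apply: le_trans le1.
rewrite lerD2r; apply: qmin; first exact: sublinear_shift_inf.
move=> z; apply: le_trans (shift_inf_le y z sq (lexx 0)) _.
by rewrite scale0r addr0 mul0r subr0.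
Qed.

Lemma real_functional_complexification (f : V -> R) :
  (forall x y, f (x + y) = f x + f y) ->
  (forall (s : R) x, f (s%:C *: x) = s * f x) ->
  scalar (fun x => f x -i* f ('i *: x)).
Proof.
move=> fD fZ [a b] x y /=.
have fCZ z : f ((a +i* b) *: z) = a * f z + b * f ('i *: z).
  by rewrite [X in X *: _]complexE/= scalerDl [_ * b%:C]mulrC -scalerA fD !fZ.
have ii z : f ('i *: ('i *: z)) = - f z.
  rewrite scalerA -expr2 sqr_i scaleN1r -scaleN1r.
  by rewrite -[-1]/(-(1%:C)) -rmorphN/= fZ mulN1r.
rewrite [in f ('i *: _)]scalerDr !fD scalerA [_ * (a +i* b)]mulrC -scalerA !fCZ ii.
by apply/eqP; rewrite eq_complex/=; apply/andP; split; apply/eqP; ring.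
Qed.

(** No functional is extended from a line: a minimal sublinear [q] is taken below [shift_inf p x0].
    It is additive, hence real linear, and [q (- x0) <= - p x0] yields the attained value at
    [x0]. *)
Theorem sublinear_Hahn_Banach p x0 : sublinear p ->
  exists f : {scalar V}, (forall x, complex.Re (f x) <= p x) /\
    complex.Re (f x0) = p x0.
Proof.
move=> sp; have [q [sq qle qmin]] :=
  exists_minimal_sublinear (sublinear_shift_inf x0 sp).
have qD := minimal_sublinearD sq qmin.
have qN x : q (- x) = - q x.
  by apply/eqP; rewrite -subr_eq0 opprK -qD addNr sublinear0.
have qZ (s : R) x : q (s%:C *: x) = s * q x.
  have [/sq.2->//|s0] := leP 0 s.
  rewrite -[s]opprK rmorphN/= scaleNr qN sq.2 ?mulNr//.
  by rewrite oppr_ge0 ltW.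
have qp x : q x <= p x.
  apply: le_trans (qle x) (le_trans (shift_inf_le x0 x sp (lexx 0)) _).
  by rewrite scale0r addr0 mul0r subr0.
pose f x := q x -i* q ('i *: x).
have flin : scalar f := real_functional_complexification qD qZ.
exists (HB.pack f (GRing.isLinear.Build _ _ _ _ f flin) : {scalar V}).
split=> //=; apply/eqP; rewrite eq_le qp/= -lerN2 -qN.
apply: le_trans (qle _) (le_trans (shift_inf_le x0 _ sp ler01) _).
by rewrite scale1r addNr sublinear0// mul1r sub0r.
Qed.

End HahnBanach.

(** * C*-algebras *)

Section StarAlgebraTheory.
Context {R : realType} {A : starAlgType R}.
Implicit Types (a b : A) (t : R).

Lemma conjRC (t : R) : Num.conj t%:C = t%:C.
Proof. by apply: conj_Creal; rewrite complex_real. Qed.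

Lemma complexi_mul : 'i%C * 'i%C = -1 :> R[i].
Proof. by rewrite -expr2 sqr_i. Qed.

Lemma conj_complexi : Num.conj ('i%C : R[i]) = - 'i%C.
Proof.
have i0 : ('i%C : R[i]) != 0 by rewrite -sqrf_eq0 sqr_i oppr_eq0 oner_eq0.
apply: (mulfI i0); rewrite -normCK mulrN -expr2 sqr_i opprK normc_def/=.
by rewrite expr0n/= add0r expr1n sqrtr1 rmorph1 expr1n.
Qed.

Lemma starD a b : star (a + b) = star a + star b.
Proof. by rewrite -[a]scale1r starP conjC1 !scale1r. Qed.

Lemma star0 : star (0 : A) = 0.
Proof. by apply: (addIr (star (0 : A))); rewrite -starD !add0r. Qed.

Lemma starZ (c : R[i]) a : star (c *: a) = Num.conj c *: star a.
Proof. by rewrite -[c *: a]addr0 starP star0 addr0. Qed.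

Lemma starN a : star (- a) = - star a.
Proof. by rewrite -scaleN1r starZ rmorphN1 scaleN1r. Qed.

Lemma starB a b : star (a - b) = star a - star b.
Proof. by rewrite starD starN. Qed.

Lemma starZr t a : star (t%:C *: a) = t%:C *: star a.
Proof. by rewrite starZ conjRC. Qed.

Lemma star1 : star (1 : A) = 1.
Proof. by rewrite -[LHS]mul1r -[X in X * _]starK -starM mul1r starK. Qed.

End StarAlgebraTheory.

(** * The C*-norm and square roots of [1 - u] *)

Section CStarAlgebraTheory.
Context {R : realType} {A : cstarAlgType R}.
Implicit Types (a b h k u x y z : A) (r s t : R).

Lemma cnormZr t a : cnorm (t%:C *: a) = `|t| * cnorm a.
Proof.
apply: complexI; rewrite cnormZ normc_def /= expr0n addr0 sqrtr_sqr.
by rewrite rmorphM.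
Qed.

Lemma cnormN a : cnorm (- a) = cnorm a.
Proof.
rewrite -scaleN1r -[-1](rmorphN1 (real_complex R)) cnormZr.
by rewrite normrN1 mul1r.
Qed.

Lemma cnorm0 : cnorm (0 : A) = 0.
Proof. by rewrite -(scale0r 0) cnormZr normr0 mul0r. Qed.

Lemma cnorm_ge0 a : 0 <= cnorm a.
Proof.
have := cnormD a (- a); rewrite subrr cnorm0 cnormN.
by rewrite -mulr2n pmulrn_lge0.
Qed.

Lemma cnormB a b : cnorm (a - b) <= cnorm a + cnorm b.
Proof. by rewrite -[cnorm b]cnormN; exact: cnormD. Qed.

Lemma cnormC a b : cnorm (a - b) = cnorm (b - a).
Proof. by rewrite -cnormN opprB. Qed.

Lemma cnorm1 : cnorm (1 : A) = 1.
Proof.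
have := cnorm_starM (1 : A); rewrite star1 mul1r => /esym/eqP.
rewrite -subr_eq0 expr2 -[X in _ - X]mulr1 -mulrBr mulf_eq0.
case/orP => [/eqP/cnorm_eq0/eqP|]; first by rewrite oner_eq0.
by rewrite subr_eq0 => /eqP.
Qed.

Lemma cnormRA t : 0 <= t -> cnorm (t%:C%:A : A) = t.
Proof. by move=> t0; rewrite cnormZr cnorm1 mulr1 ger0_norm. Qed.

(** The C*-identity and submultiplicativity give [cnorm b ^+ 2 <= cnorm (star b) * cnorm b]; divide
    by [cnorm b] and exchange [b] with [star b]. *)
Lemma cnorm_star a : cnorm (star a) = cnorm a.
Proof.
suff le b : cnorm b <= cnorm (star b).
  by apply/eqP; rewrite eq_le -[X in _ <= cnorm X]starK !le.
have [->|b0] := eqVneq b 0; first by rewrite star0.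
have nb0 : 0 < cnorm b.
  rewrite lt_neqAle cnorm_ge0 andbT eq_sym; apply: contra b0.
  by move=> /eqP/cnorm_eq0 ->.
rewrite -(ler_pM2r nb0) -expr2 -cnorm_starM; exact: cnormM.
Qed.

Lemma cnorm_sqr a : star a = a -> cnorm (a * a) = cnorm a ^+ 2.
Proof. by move=> sa; rewrite -cnorm_starM sa. Qed.

Lemma cnorm_eps_eq0 a : (forall e, 0 < e -> cnorm a <= e) -> a = 0.
Proof.
move=> ae; apply: cnorm_eq0; apply/eqP; rewrite eq_le cnorm_ge0 andbT.
by apply/ler_addgt0Pl => e e0; rewrite addr0 ae.
Qed.

(* [y = (u + y^2)/2] says that [(1 - y)^2 = 1 - u]. *)
Fixpoint sqrt_iter u (n : nat) : A :=
  if n is m.+1 then 2^-1%:C *: (u + sqrt_iter u m * sqrt_iter u m) else 0.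

(** The same iteration for the scalar [u = 1], serving as a majorant for every [u] of norm at most
    1. *)
Fixpoint sqrt_bound (n : nat) : R :=
  if n is m.+1 then 2^-1 * (1 + sqrt_bound m * sqrt_bound m) else 0.

Lemma sqrt_bound01 n : 0 <= sqrt_bound n <= 1.
Proof.
elim: n => [|n /andP[q0 q1]] /=; first by rewrite lexx ler01.
have q2 : sqrt_bound n * sqrt_bound n <= 1 by rewrite mulr_ile1.
rewrite mulr_ge0 ?invr_ge0//=; last by rewrite addr_ge0// mulr_ge0.
by rewrite ler_pdivrMl// mulr1 -[2]/(1 + 1) lerD2l.
Qed.

Lemma cnorm_sqrt_iter u n : cnorm u <= 1 ->
  cnorm (sqrt_iter u n) <= sqrt_bound n.
Proof.
move=> u1; elim: n => [|n IHn] /=; first by rewrite cnorm0.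
rewrite cnormZr ger0_norm ?invr_ge0// ler_pM2l ?invr_gt0//.
apply: le_trans (cnormD _ _) (lerD u1 (le_trans (cnormM _ _) _)).
by rewrite ler_pM// cnorm_ge0.
Qed.

Lemma cnorm_sqr_sub a b :
  cnorm (a * a - b * b) <= (cnorm a + cnorm b) * cnorm (a - b).
Proof.
have -> : a * a - b * b = a * (a - b) + (a - b) * b.
  by rewrite mulrBr mulrBl addrA subrK.
apply: le_trans (cnormD _ _) _; rewrite [leRHS]mulrDl.
by apply: lerD; rewrite ?[cnorm b * _]mulrC; exact: cnormM.
Qed.

(** Successive steps are half the differences of squares of the previous iterates. [cnorm_sqr_sub]
    bounds these by a product, and for the scalar majorant the same product is an exact
    factorization. *)
Lemma sqrt_iter_step u n : cnorm u <= 1 ->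
  cnorm (sqrt_iter u n.+1 - sqrt_iter u n) <= sqrt_bound n.+1 - sqrt_bound n.
Proof.
move=> u1; elim: n => [|n IHn].
  by rewrite /= !subr0 !mulr0 !addr0 cnormZr ger0_norm ?invr_ge0//
    ler_pM2l ?invr_gt0.
have E x y z : 2^-1%:C *: (x + y) - 2^-1%:C *: (x + z) = 2^-1%:C *: (y - z).
  by rewrite -scalerBr opprD addrACA subrr add0r.
rewrite /= in IHn; rewrite /= E cnormZr ger0_norm ?invr_ge0//.
rewrite -mulrBr ler_pM2l ?invr_gt0//.
apply: le_trans (cnorm_sqr_sub _ _) _.
have -> : forall a b : R, 1 + a * a - (1 + b * b) = (a + b) * (a - b).
  by move=> a b; ring.
apply: ler_pM IHn; rewrite ?addr_ge0 ?cnorm_ge0//.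
by apply: lerD; [exact: (@cnorm_sqrt_iter u n.+1)|exact: cnorm_sqrt_iter].
Qed.

Lemma sqrt_bound_le n : sqrt_bound n <= sqrt_bound n.+1.
Proof.
rewrite -subr_ge0; apply: le_trans (cnorm_ge0 _) (@sqrt_iter_step 1 n _).
by rewrite cnorm1.
Qed.

Lemma sqrt_iter_dist u m n : cnorm u <= 1 -> (m <= n)%N ->
  cnorm (sqrt_iter u n - sqrt_iter u m) <= sqrt_bound n - sqrt_bound m.
Proof.
move=> u1; elim: n => [|n IHn].
  by rewrite leqn0 => /eqP ->; rewrite !subrr cnorm0.
rewrite leq_eqVlt => /predU1P[->|]; first by rewrite !subrr cnorm0.
rewrite ltnS => /IHn le_n.
rewrite -(subrKA (sqrt_iter u n)) -(subrKA (sqrt_bound n)).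
exact: le_trans (cnormD _ _) (lerD (sqrt_iter_step _ u1) le_n).
Qed.

(** The majorant is increasing and bounded, so its increments make the iterates Cauchy. Two
    consecutive iterates are controlled at once because the recurrence links them. *)
Lemma sqrt_iter_cvg u : cnorm u <= 1 -> exists y,
  forall e : R, 0 < e -> exists n,
    cnorm (sqrt_iter u n - y) <= e /\ cnorm (sqrt_iter u n.+1 - y) <= e.
Proof.
move=> u1; have [e e0|y /cvgrPdist_le cy] := @cnorm_complete R A (sqrt_iter u).
  have q_sup : has_sup (range sqrt_bound).
    split; first by exists 0, 0%N.
    by exists 1 => _ [n _ <-]; case/andP: (sqrt_bound01 n).
  have [_ [N _ <-] ltN] := sup_adherent e0 q_sup.
  have q_lt n : (N <= n)%N -> sqrt_bound n - sqrt_bound N < e.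
    move=> Nn; rewrite ltrBlDr -ltrBlDl; apply: le_lt_trans ltN.
    by rewrite lerD2r; apply: (sup_upper_bound q_sup); exists n.
  exists N => m n Nm Nn; wlog mn : m n Nm Nn / (n <= m)%N.
    move=> th; case/orP: (leq_total n m) => [|nm]; first exact: th.
    by rewrite cnormC; exact: th.
  apply: le_lt_trans (sqrt_iter_dist u1 mn) (le_lt_trans _ (q_lt m Nm)).
  rewrite lerD2l lerN2; elim: n Nn {mn} => [|n IHn].
    by rewrite leqn0 => /eqP ->.
  rewrite leq_eqVlt => /predU1P[->//|]; rewrite ltnS => /IHn/le_trans; apply.
  exact: sqrt_bound_le.
exists y => e /cy[N _ Ny]; exists N.
have := Ny N (leqnn _); have := Ny N.+1 (leqnSn _) => /=.
by rewrite !sub0r !normrN !ger0_norm ?cnorm_ge0//.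
Qed.

(** The recurrence passes to the limit as [u + y * y = 2 y]. Self-adjointness and commutation hold
    for every iterate, a polynomial in [u], and survive the limit. *)
Lemma sqrt_one_sub u : star u = u -> cnorm u <= 1 -> exists y,
  [/\ star y = y, cnorm y <= 1, (1 - y) * (1 - y) = 1 - u &
    forall b, GRing.comm b u -> GRing.comm b y].
Proof.
move=> su u1; have [y cy] := sqrt_iter_cvg u1.
have sy n : star (sqrt_iter u n) = sqrt_iter u n.
  by elim: n => [|n IHn] /=; rewrite ?star0// starZr starD starM su IHn.
have yn1 n : cnorm (sqrt_iter u n) <= 1.
  by apply: le_trans (cnorm_sqrt_iter _ u1) _; case/andP: (sqrt_bound01 n).
have y1 : cnorm y <= 1.
  apply/ler_addgt0Pr => e /cy[n [yn _]].
  rewrite -[y](subKr (sqrt_iter u n)).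
  exact: le_trans (cnormB _ _) (lerD (yn1 _) yn).
have {}cy K e : 0 < K -> 0 < e -> exists n,
    K * cnorm (sqrt_iter u n - y) <= e /\ K * cnorm (sqrt_iter u n.+1 - y) <= e.
  move=> K0 e0; have [|n [yn yn']] := cy (K^-1 * e).
    by rewrite mulr_gt0 ?invr_gt0.
  by exists n; rewrite -!ler_pdivlMl.
exists y; split=> //.
- apply: subr0_eq; apply: cnorm_eps_eq0 => e e0.
  have [n [yn _]] := cy 2 e ltac:(by []) e0.
  have -> : star y - y = star (y - sqrt_iter u n) + (sqrt_iter u n - y).
    by rewrite starB sy subrKA.
  apply: le_trans (cnormD _ _) _.
  by rewrite cnorm_star cnormC -mulr2n -mulr_natl.
- suff uy : u + y * y = 2%:C *: y.
    have -> : u = y + y - y * y.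
      by rewrite -[y + y]mulr2n -scaler_nat -(rmorph_nat (real_complex R)) -uy addrK.
    rewrite mulrBl mul1r mulrBr mulr1 !opprB opprD -addrA; congr (1 + _).
    by rewrite addrC -addrA.
  apply: subr0_eq; apply: cnorm_eps_eq0 => e e0.
  (* Two errors arise, each at most twice a distance to [y]: one from the factor 2, one from the
     norms of the iterate and of [y], both at most 1. Hence the constant 4. *)
  have [n [yn yn']] := cy 4 e ltac:(by []) e0.
  have -> : u + y * y - 2%:C *: y =
      2%:C *: (sqrt_iter u n.+1 - y) - (sqrt_iter u n * sqrt_iter u n - y * y).
    rewrite scalerBr /= scalerA -rmorphM/= mulfV// scale1r opprB.
    by rewrite [RHS]addrAC -[u + _ + _ in RHS]addrA [_ + (y * y - _)]addrC subrK.
  apply: le_trans (cnormB _ _) _; rewrite cnormZr ger0_norm//.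
  have := cnorm_sqr_sub (sqrt_iter u n) y.
  have := yn1 n; have := cnorm_ge0 (sqrt_iter u n - y).
  move: (cnorm (sqrt_iter u n - y)) (cnorm (sqrt_iter u n)) yn => d c yn d0 c1 le_d.
  have : (c + cnorm y) * d <= 2 * d by rewrite ler_wpM2r//; lra.
  by move: yn'; lra.
- move=> b bu; have byn n : GRing.comm b (sqrt_iter u n).
    elim: n => [|n IHn] /=; first exact: commr0.
    rewrite /GRing.comm -scalerAl -scalerAr; congr (_ *: _).
    by apply: commrD => //; exact: commrM.
  apply: subr0_eq; apply: cnorm_eps_eq0 => e e0.
  (* The commutator error is at most [2 * cnorm b] times the distance; adding 1 keeps the factor
     positive when [b = 0]. *)
  have b0 : 0 < 2 * cnorm b + 1 by rewrite ltr_wpDl// mulr_ge0 ?cnorm_ge0.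
  have [n [yn _]] := cy _ e b0 e0; apply: le_trans yn.
  have -> : b * y - y * b = (sqrt_iter u n - y) * b - b * (sqrt_iter u n - y).
    by rewrite mulrBl mulrBr (byn n) opprB [RHS]addrC subrKA.
  apply: le_trans (cnormB _ _) _.
  have := cnorm_ge0 (sqrt_iter u n - y).
  have := cnormM b (sqrt_iter u n - y); have := cnormM (sqrt_iter u n - y) b.
  by move=> h1 h2 h3; lra.
Qed.

End CStarAlgebraTheory.

(** * Positive elements and the Kelley-Vaught theorem *)

Section CStarPositivity.
Context {R : realType} {A : cstarAlgType R}.
Implicit Types (a b h k u w x y z : A) (r s t : R).

(* By the spectral theorem, this says that the spectrum of [h] is contained
   in [0, 2t]. *)
Definition cpos h : Prop :=
  star h = h /\ exists t, cnorm (t%:C%:A - h) <= t.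

Lemma starRA t : star (t%:C%:A : A) = t%:C%:A.
Proof. by rewrite starZr star1. Qed.

Lemma cposRA t : 0 <= t -> cpos t%:C%:A.
Proof. by move=> t0; split; [exact: starRA|exists t; rewrite subrr cnorm0]. Qed.

Lemma cpos0 : cpos 0.
Proof.
rewrite -(scale0r 1) -[0 : R[i]](rmorph0 (real_complex R)).
exact: cposRA.
Qed.

Lemma cposZ s h : 0 <= s -> cpos h -> cpos (s%:C *: h).
Proof.
move=> s0 [sh [t ht]]; split; first by rewrite starZr sh.
exists (s * t); rewrite rmorphM -scalerA -scalerBr cnormZr ger0_norm//.
exact: ler_wpM2l.
Qed.

Lemma cposD h k : cpos h -> cpos k -> cpos (h + k).
Proof.
move=> [sh [s hs]] [sk [t kt]]; split; first by rewrite starD sh sk.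
exists (s + t); rewrite rmorphD scalerDl opprD addrACA.
exact: le_trans (cnormD _ _) (lerD hs kt).
Qed.

Lemma cpos_norm_sub t h : star h = h -> cnorm h <= t -> cpos (t%:C%:A - h).
Proof.
by move=> sh ht; split; [rewrite starB starRA sh|exists t; rewrite subKr].
Qed.

(** For [t > 0], [u = 1 - h / t] has norm at most 1, and [(1 - y)^2 = 1 - u] makes [sqrt t (1 - y)]
    a root of [h]. Since [y] has norm at most 1, [sqrt t] witnesses its positivity. If [t = 0] then
    [h = 0]. *)
Lemma cpos_sqrt h : cpos h -> exists k, [/\ cpos k, k * k = h &
  forall b, GRing.comm b h -> GRing.comm b k].
Proof.
move=> [sh [t ht]].
have := le_trans (cnorm_ge0 _) ht; rewrite le_eqVlt => /predU1P[t0|t0].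
  exists 0; split; [exact: cpos0| |by move=> b _; exact: commr0].
  have := ht; rewrite -t0 rmorph0 scale0r sub0r cnormN => h0.
  by rewrite mulr0; apply/esym/cnorm_eq0/eqP; rewrite eq_le h0 cnorm_ge0.
pose u := 1 - t^-1%:C *: h.
have hE : h = t%:C *: (1 - u).
  by rewrite subKr scalerA -rmorphM/= mulfV ?scale1r// gt_eqF.
have su : star u = u by rewrite starB star1 starZr sh.
have u1 : cnorm u <= 1.
  rewrite -(ler_pM2l t0) mulr1 -[t in t * _](ger0_norm (ltW t0)) -cnormZr.
  by rewrite scalerBr scalerA -rmorphM/= mulfV ?gt_eqF// scale1r.
have [y [sy y1 yE cy]] := sqrt_one_sub su u1.
exists ((Num.sqrt t)%:C *: (1 - y)); split.
- split; first by rewrite starZr starB star1 sy.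
  exists (Num.sqrt t); rewrite -scalerBr subKr cnormZr ger0_norm ?sqrtr_ge0//.
  by rewrite ler_piMr ?sqrtr_ge0.
- rewrite -scalerAl -scalerAr scalerA -rmorphM -expr2 sqr_sqrtr ?ltW//.
  by rewrite yE -hE.
- move=> b bh; rewrite /GRing.comm -scalerAl -scalerAr; congr (_ *: _).
  apply: commrB; first exact: commr1.
  apply: cy; apply: commrB; first exact: commr1.
  by rewrite /GRing.comm -scalerAl -scalerAr bh.
Qed.

(** For [z = x + i y], commutation gives [star z * z = x * x + y * y], while [x] is the mean of [z]
    and [star z], so its norm is at most that of [z]. *)
Lemma cnorm_sqr_le x y : star x = x -> star y = y -> GRing.comm x y ->
  cnorm x ^+ 2 <= cnorm (x * x + y * y).
Proof.
move=> sx sy xy; pose z := x + 'i%C *: y.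
have sz : star z = x - 'i%C *: y.
  by rewrite starD starZ sx sy conj_complexi scaleNr.
have zz : star z * z = x * x + y * y.
  rewrite sz mulrDr !mulrBl -!scalerAl -!scalerAr scalerA complexi_mul.
  by rewrite scaleN1r opprK xy subrKA.
rewrite -zz cnorm_starM ler_pXn2r ?nnegrE ?cnorm_ge0//.
have x2 : 2%:C *: x = z + star z.
  by rewrite sz addrACA subrr addr0 rmorph_nat scaler_nat mulr2n.
have := cnormD z (star z); rewrite cnorm_star -x2 cnormZr ger0_norm//.
by move=> h; lra.
Qed.

(** After scaling, [1 - x * x] is the square of a self-adjoint [w] commuting with [x], and
    [cnorm_sqr_le] bounds its norm by that of [w * w + x * x = 1]. *)
Lemma cpos_sqr x : star x = x -> cpos (x * x).
Proof.
move=> sx; wlog x1 : x sx / cnorm x <= 1.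
  move=> th; pose c := 1 + cnorm x.
  have c0 : 0 < c by rewrite ltr_pwDl ?cnorm_ge0.
  have -> : x = c%:C *: (c^-1%:C *: x).
    by rewrite scalerA -rmorphM/= mulfV ?gt_eqF// scale1r.
  rewrite -scalerAl -scalerAr scalerA -rmorphM.
  apply: cposZ; first by rewrite mulr_ge0// ltW.
  apply: th; first by rewrite starZr sx.
  rewrite cnormZr ger0_norm ?invr_ge0 ?(ltW c0)// mulrC ler_pdivrMr// mul1r.
  by rewrite lerDr.
have sxx : star (x * x) = x * x by rewrite starM sx.
have xx1 : cnorm (x * x) <= 1.
  by rewrite cnorm_sqr// expr_le1 ?cnorm_ge0.
have [y [sy _ yE cy]] := sqrt_one_sub sxx xx1.
split=> //; exists 1; rewrite rmorph1 scale1r -yE.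
have sw : star (1 - y) = 1 - y by rewrite starB star1 sy.
rewrite cnorm_sqr//; apply: le_trans (cnorm_sqr_le sw sx _) _.
  apply/commr_sym/commrB; first exact: commr1.
  by apply: cy; exact: commrM.
by rewrite yE subrK cnorm1.
Qed.

(** A root commutes with whatever commutes with its square, so the roots [g] and [l] commute and
    [h * k] is the square of the self-adjoint [g * l]. *)
Lemma cposM h k : GRing.comm h k -> cpos h -> cpos k -> cpos (h * k).
Proof.
move=> hk /cpos_sqrt[g [[sg _] gE cg]] /cpos_sqrt[l [[sl _] lE cl]].
have gl : GRing.comm g l by apply/cl/commr_sym/cg/commr_sym.
have -> : h * k = (g * l) * (g * l).
  by rewrite -gE -lE -!mulrA; congr (_ * _); rewrite !mulrA gl.
by apply: cpos_sqr; rewrite starM sg sl.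
Qed.

(** The roots of [u] and [t - u] commute and their squares add up to the scalar [t], so
    [cnorm_sqr_le] applies. *)
Lemma cpos_le t u : 0 <= t -> cpos u -> cpos (t%:C%:A - u) -> cnorm u <= t.
Proof.
move=> t0 /cpos_sqrt[g [[sg _] gE cg]] /cpos_sqrt[l [[sl _] lE cl]].
have gl : GRing.comm g l.
  apply/commr_sym/cg/commr_sym; rewrite /GRing.comm.
  have : GRing.comm u l.
    apply: cl; apply: commrB; last by [].
    by rewrite /GRing.comm -scalerAl -scalerAr mulr1 mul1r.
  exact.
have := cnorm_sqr_le sg sl gl.
by rewrite -cnorm_sqr// gE lE addrC subrK cnormRA.
Qed.

Lemma cpos_norm_le u w : cpos u -> cpos w -> cpos (w - u) -> cnorm u <= cnorm w.
Proof.
move=> pu pw wu; apply: cpos_le => //; first exact: cnorm_ge0.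
rewrite -(subrKA w); apply: cposD => //.
by apply: cpos_norm_sub => //; case: pw.
Qed.

Lemma cpos_anti h : cpos h -> cpos (- h) -> h = 0.
Proof.
move=> ph nh; apply: cnorm_eq0; apply/eqP; rewrite eq_le cnorm_ge0 andbT.
by apply: cpos_le => //; rewrite scale0r sub0r.
Qed.

Lemma cpos_one_sub z : cpos z -> cnorm z <= 1 -> cnorm (1 - z) <= 1.
Proof.
move=> pz z1; have := @cpos_norm_sub 1 z pz.1 z1.
rewrite scale1r => p1z; apply: cpos_le => //.
by rewrite scale1r subKr.
Qed.

(** Bernoulli's inequality. If [b] is the remainder at [n], passing to [n + 1] adds [k * b] and [n]
    copies of [k * k], both positive. *)
Lemma cpos_bernoulli k n : cpos k ->
  cpos ((1 + k) ^+ n - 1 - k *+ n).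
Proof.
move=> pk; elim: n => [|n IHn].
  by rewrite expr0 mulr0n subrr subr0; exact: cpos0.
set b := (_ - _) in IHn.
have kb : GRing.comm k b.
  apply: commrB; last exact: commrMn.
  apply: commrB; last exact: commr1.
  by apply: commrX; apply: commrD => //; exact: commr1.
have bE : (1 + k) ^+ n = b + k *+ n + 1 by rewrite /b !subrK.
move: b IHn kb bE => b IHn kb bE.
have -> : (1 + k) ^+ n.+1 - 1 - k *+ n.+1 = b + (k * b + (k * k) *+ n).
  rewrite exprS mulrDl mul1r.
  rewrite bE !mulrDr mulr1 mulrnAr mulrS.
  apply/eqP; rewrite !subr_eq; apply/eqP.
  by rewrite !addrA [LHS](@GRing.add A).[ACl 1*4*5*6*2*3].
apply: cposD => //; apply: cposD; first exact: cposM.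
rewrite -scaler_nat -(rmorph_nat (real_complex R)).
by apply: cposZ; [exact: ler0n|exact: cpos_sqr pk.1].
Qed.

(* With [k := - d^* d] and [z := d d^*] both positive,
   [(1 + k) d^* = d^* (1 - z)], so that [(1 + k)^n k = - d^* (1 - z)^n d] is
   bounded in [n] although it dominates [n k^2]. *)
Lemma cpos_opp_star_mul d : cpos (- (star d * d)) -> d = 0.
Proof.
wlog d1 : d / cnorm d <= 1.
  move=> th pd; pose c := 1 + cnorm d.
  have c0 : 0 < c by rewrite ltr_pwDl ?cnorm_ge0.
  have -> : d = c%:C *: (c^-1%:C *: d).
    by rewrite scalerA -rmorphM/= mulfV ?gt_eqF// scale1r.
  rewrite (th (c^-1%:C *: d)) ?scaler0//.
    rewrite cnormZr ger0_norm ?invr_ge0 ?(ltW c0)// mulrC ler_pdivrMr// mul1r.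
    by rewrite lerDr.
  rewrite starZr -scalerAl -scalerAr scalerA -rmorphM -scalerN.
  by apply: cposZ => //; rewrite mulr_ge0// invr_ge0 ltW.
set k := - _ => pk; pose z := d * star d.
(* The squares of the real and imaginary parts of [d], doubled, add up to [star d * d + d * star d];
   adding [k = - (star d * d)] leaves [d * star d], a sum of positive elements. *)
have pz : cpos z.
  have -> : z = k + 2^-1%:C *: ((d + star d) * (d + star d) +
                 ('i%C *: (d - star d)) * ('i%C *: (d - star d))).
    rewrite -scalerAl -scalerAr scalerA complexi_mul scaleN1r.
    set e := star d.
    have -> : (d + e) * (d + e) = (d * d + e * e) + (e * d + d * e).
      by rewrite mulrDr !mulrDl [d * e + _]addrC addrACA.
    have -> : (d - e) * (d - e) = (d * d + e * e) - (e * d + d * e).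
      by rewrite mulrBr !mulrBl opprB addrACA opprD.
    rewrite opprB [_ + _ + (_ - _)]addrC subrKA.
    have h2 : 2^-1 + 2^-1 = 1 :> R by lra.
    by rewrite scalerDr -scalerDl -rmorphD/= h2 scale1r addKr.
  apply: cposD => //; apply: cposZ; first by rewrite invr_ge0.
  apply: cposD; apply: cpos_sqr; first by rewrite starD starK addrC.
  rewrite starZ starB starK.
  by rewrite conj_complexi scaleNr -scalerN opprB.
have z1 : cnorm (1 - z) <= 1.
  apply: cpos_one_sub => //; apply: le_trans (cnormM _ _) _.
  by rewrite cnorm_star mulr_ile1 ?cnorm_ge0.
have kz n : (1 + k) ^+ n * star d = star d * (1 - z) ^+ n.
  elim: n => [|n IHn]; first by rewrite !expr0 mul1r mulr1.
  rewrite exprSr -mulrA.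
  have -> : (1 + k) * star d = star d * (1 - z).
    by rewrite mulrDl mul1r mulrBr mulr1 mulNr mulrA.
  by rewrite mulrA IHn -mulrA -exprSr.
have z1n n : cnorm ((1 - z) ^+ n) <= 1.
  elim: n => [|n IHn]; first by rewrite expr0 cnorm1.
  by rewrite exprS; apply: le_trans (cnormM _ _) _; rewrite mulr_ile1 ?cnorm_ge0.
have kn n : cnorm (k * k) *+ n <= 1.
  rewrite -[leLHS]ger0_norm ?mulrn_wge0 ?cnorm_ge0// -mulr_natl normrM.
  rewrite [`|cnorm _|]ger0_norm ?cnorm_ge0// -cnormZr.
  apply: (@le_trans _ _ (cnorm ((1 + k) ^+ n * k))).
    have pkk : cpos (n%:R%:C *: (k * k)).
      by apply: cposZ; [exact: ler0n|exact: cpos_sqr pk.1].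
    have dE : (1 + k) ^+ n * k - n%:R%:C *: (k * k) =
        ((1 + k) ^+ n - 1 - k *+ n) * k + k.
      by rewrite !mulrBl mul1r mulrnAl rmorph_nat scaler_nat addrAC subrK.
    have pdiff : cpos ((1 + k) ^+ n * k - n%:R%:C *: (k * k)).
      rewrite dE; apply: cposD => //; apply: cposM => //.
        apply/commr_sym/commrB; last exact: commrMn.
        apply: commrB; last exact: commr1.
        by apply: commrX; apply: commrD => //; exact: commr1.
      exact: cpos_bernoulli.
    apply: cpos_norm_le => //.
    by rewrite -(subrK (n%:R%:C *: (k * k)) (_ * k)); exact: cposD.
  rewrite {2}/k mulrN cnormN mulrA kz -mulrA.
  apply: le_trans (cnormM _ _) _; rewrite mulr_ile1 ?cnorm_ge0 ?cnorm_star//.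
  apply: le_trans (cnormM _ _) _; rewrite mulr_ile1 ?cnorm_ge0//.
(* By the Archimedean property, multiples of a nonzero [cnorm (k * k)] could not all stay below
   1. *)
have k0 : k = 0.
  apply: cnorm_eq0; apply/eqP; rewrite -sqrf_eq0 -cnorm_sqr ?pk.1//.
  have := cnorm_ge0 (k * k); rewrite le_eqVlt => /predU1P[<-//|kk0].
  have := kn (Num.bound (cnorm (k * k))^-1).
  rewrite -mulr_natl -ler_pdivlMr// mul1r leNgt.
  by rewrite archi_boundP// invr_ge0 ltW.
apply: cnorm_eq0; apply/eqP; rewrite -sqrf_eq0 -cnorm_starM.
by rewrite -cnormN -/k k0 cnorm0.
Qed.

(** Here [s] is the absolute value of [x = star a * a], and [m = s - x] is twice its negative part.
    Since [x * m = - (s * m)], the element [- star (a * m) * (a * m)] equals [m * s * m], a square,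
    so [a * m = 0]. Then [x * m] and [s * m] vanish, hence [m * m = 0] and [x = s]. *)
Theorem cpos_star_mul a : cpos (star a * a).
Proof.
set x := star a * a.
have sx : star x = x by rewrite /x starM starK.
have [s [ps sE cs]] := cpos_sqrt (cpos_sqr sx).
have [r [pr rE cr]] := cpos_sqrt ps.
have xs : GRing.comm x s by apply: cs; exact: commrM.
pose m := s - x.
have sm : star m = m by rewrite starB sx ps.1.
have xm : x * m = - (s * m).
  by rewrite mulrBr mulrBr xs -sE opprB.
have rm : GRing.comm m r.
  by apply: cr; apply/commr_sym/commrB => //; exact/commr_sym.
have mam : a * m = 0.
  apply: cpos_opp_star_mul; rewrite starM sm.
  have -> : - (m * star a * (a * m)) = (r * m) * (r * m).
    rewrite -mulrA [star a * _]mulrA -/x xm mulrN opprK.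
    by rewrite -rE !mulrA rm.
  by apply: cpos_sqr; rewrite starM sm pr.1 rm.
have sm0 : s * m = 0.
  by apply: oppr_inj; rewrite -xm oppr0 /x -mulrA mam mulr0.
have m0 : m = 0.
  apply: cnorm_eq0; apply/eqP; rewrite -sqrf_eq0 -cnorm_sqr//.
  by rewrite {1}/m mulrBl xm opprK sm0 addr0 cnorm0.
by rewrite -[x](subKr s) -/m m0 subr0.
Qed.

End CStarPositivity.

(** * States *)

Section States.
Context {R : realType} {A : cstarAlgType R}.
Implicit Types (a b h k u w x y z : A) (r s t : R) (tau : state A).

Definition herm_part a : A := 2^-1%:C *: (a + star a).

Lemma herm_partD a b : herm_part (a + b) = herm_part a + herm_part b.
Proof. by rewrite /herm_part starD addrACA scalerDr. Qed.

Lemma herm_partZ t a : herm_part (t%:C *: a) = t%:C *: herm_part a.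
Proof. by rewrite /herm_part starZr -scalerDr !scalerA mulrC. Qed.

Lemma herm_partN a : herm_part (- a) = - herm_part a.
Proof. by rewrite /herm_part starN -opprD scalerN. Qed.

Lemma star_herm_part a : star (herm_part a) = herm_part a.
Proof. by rewrite starZr starD starK addrC. Qed.

Lemma herm_part_id a : star a = a -> herm_part a = a.
Proof.
have h2 : 2^-1 + 2^-1 = 1 :> R by lra.
by move=> sa; rewrite /herm_part sa scalerDr -scalerDl -rmorphD/= h2 scale1r.
Qed.

Lemma herm_part_i h : star h = h -> herm_part ('i%C *: h) = 0.
Proof.
by move=> sh; rewrite /herm_part starZ sh conj_complexi scaleNr subrr scaler0.
Qed.

Lemma herm_part_eq0 a :
  herm_part a = 0 -> herm_part ('i%C *: a) = 0 -> a = 0.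
Proof.
rewrite /herm_part starZ conj_complexi scaleNr -scalerBr => /eqP ap /eqP am.
have a1 : a + star a = 0.
  move: ap; rewrite scaler_eq0 => /orP[/eqP/complexI/eqP|/eqP//].
  by rewrite invr_eq0 pnatr_eq0.
have a2 : a - star a = 0.
  move: am; rewrite !scaler_eq0 => /or3P[/eqP/complexI/eqP| |/eqP//].
    by rewrite invr_eq0 pnatr_eq0.
  by rewrite -sqrf_eq0 sqr_i oppr_eq0 oner_eq0.
rewrite -(herm_part_id (a := a)) /herm_part ?a1 ?scaler0//.
by apply/esym/subr0_eq.
Qed.

Definition upper_bounds_of a : set R :=
  [set t | cpos (t%:C%:A - herm_part a)].

(** In spectral terms, the maximum of the spectrum of the real part of [a]. *)
Definition csup a : R := inf (upper_bounds_of a).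

Lemma upper_bounds_of_norm a : upper_bounds_of a (cnorm (herm_part a)).
Proof. by apply: cpos_norm_sub => //; exact: star_herm_part. Qed.

(** For [t < 0] both [t] and [- t] would be positive scalars of the algebra, forcing the scalar to
    be 0, against [cnorm 1 = 1]. *)
Lemma cposRA_ge0 t : cpos (t%:C%:A : A) -> 0 <= t.
Proof.
move=> pt; rewrite leNgt; apply/negP => t0.
have nt : cpos (- (t%:C%:A : A)).
  by rewrite -scaleNr -rmorphN; apply: cposRA; rewrite oppr_ge0 ltW.
have := cpos_anti pt nt => /(congr1 (@cnorm R A)).
rewrite cnorm0 cnormZr cnorm1 mulr1 => /eqP.
by rewrite normr_eq0 lt_eqF.
Qed.

Lemma upper_bounds_of_lb a : lbound (upper_bounds_of a) (- cnorm (herm_part a)).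
Proof.
move=> t at_; have := upper_bounds_of_norm (- a).
rewrite /upper_bounds_of/= herm_partN cnormN opprK => /(cposD at_).
rewrite addrACA addNr addr0 -scalerDl -rmorphD => /cposRA_ge0.
by rewrite -lerBlDr sub0r.
Qed.

Lemma sublinear_csup : sublinear csup.
Proof.
apply: sublinear_inf.
- by move=> a; exists (cnorm (herm_part a)); exact: upper_bounds_of_norm.
- by move=> a; exists (- cnorm (herm_part a)); exact: upper_bounds_of_lb.
- move=> a b s t sa tb; exists (s + t) => //; rewrite /upper_bounds_of/=.
  by rewrite herm_partD rmorphD scalerDl opprD addrACA; exact: cposD.
- move=> r a s r0 sa; exists (r * s) => //; rewrite /upper_bounds_of/=.
  by rewrite herm_partZ rmorphM -scalerA -scalerBr; apply: cposZ => //; exact: ltW.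
- exists 0 => //; rewrite /upper_bounds_of/= rmorph0 scale0r herm_part_id ?star0//.
  by rewrite subr0; exact: cpos0.
- move=> s; rewrite /upper_bounds_of/= herm_part_id ?star0// subr0.
  exact: cposRA_ge0.
Qed.

Lemma csup_le a t : cpos (t%:C%:A - herm_part a) -> csup a <= t.
Proof.
move=> at_; apply: ge_inf => //; exists (- cnorm (herm_part a)).
exact: upper_bounds_of_lb.
Qed.

Lemma csup_lt a t : csup a < t -> cpos (t%:C%:A - herm_part a).
Proof.
move=> at_; have hi : has_inf (upper_bounds_of a).
  split; first by exists (cnorm (herm_part a)); exact: upper_bounds_of_norm.
  by exists (- cnorm (herm_part a)); exact: upper_bounds_of_lb.
have [|s sa st] := @inf_adherent _ _ (t - csup a) _ hi; first by rewrite subr_gt0.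
rewrite addrC subrK in st.
rewrite -(subrKA s%:C%:A); apply: cposD => //.
by rewrite -scalerBl -rmorphB; apply: cposRA; rewrite subr_ge0 ltW.
Qed.

Lemma csup_le0 a : csup a <= 0 -> csup (- a) <= 0 -> herm_part a = 0.
Proof.
move=> pa na; apply: cnorm_eps_eq0 => e e0.
(* With [h] the Hermitian part, [e / 3 + h] lies between 0 and [2 e / 3]; removing the scalar
   [e / 3] costs another third. *)
have e3 : 0 < e / 3 by rewrite divr_gt0.
have c1 := csup_lt (le_lt_trans pa e3).
have c2 := csup_lt (le_lt_trans na e3).
rewrite herm_partN opprK in c2.
have h2 : cnorm ((e / 3)%:C%:A + herm_part a) <= e / 3 + e / 3.
  apply: cpos_le => //; first by rewrite addr_ge0// ltW.
  by rewrite rmorphD scalerDl opprD addrACA subrr add0r.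
have := cnormB ((e / 3)%:C%:A + herm_part a) (e / 3)%:C%:A.
by rewrite addrAC subrr add0r (cnormRA (ltW e3)) => h1; lra.
Qed.

(** A functional dominated by [csup] is a state. For self-adjoint [h], [i h] has zero Hermitian
    part, which makes [f h] real; positivity uses that [star a * a] is positive; and the bounds at
    [1] and [- 1] give [f 1 = 1]. *)
Lemma exists_state_csup x0 : exists tau : state A, complex.Re (tau x0) = csup x0.
Proof.
have [f [fle fx0]] := sublinear_Hahn_Banach x0 sublinear_csup.
have f_le0 x : cpos (- herm_part x) -> complex.Re (f x) <= 0.
  by move=> px; apply: le_trans (fle x) (csup_le _); rewrite rmorph0 scale0r sub0r.
have ReN (c : R[i]) : complex.Re (- c) = - complex.Re c by case: c.
have f_real h : star h = h -> complex.Im (f h) = 0.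
  move=> sh; have ih0 : complex.Re (f ('i%C *: h)) = 0.
    apply/eqP; rewrite eq_le f_le0/=; last first.
      by rewrite herm_part_i// oppr0; exact: cpos0.
    rewrite -oppr_le0 -ReN -linearN f_le0// herm_partN herm_part_i// !oppr0.
    exact: cpos0.
  move: ih0; rewrite linearZ /=; case: (f h) => c d /=.
  by rewrite mul0r mul1r sub0r => /eqP; rewrite oppr_eq0 => /eqP.
have f_ge0 a : 0 <= f (star a * a).
  have saa : star (star a * a) = star a * a by rewrite starM starK.
  rewrite lecE f_real//= eqxx/= -oppr_le0 -ReN -linearN f_le0//.
  by rewrite herm_partN opprK herm_part_id//; exact: cpos_star_mul.
have f1 : f 1 = 1.
  have R1 : complex.Re (f 1) = 1.
    apply/eqP; rewrite eq_le; apply/andP; split.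
      apply: le_trans (fle _) (csup_le _); rewrite herm_part_id ?star1//.
      by rewrite rmorph1 scale1r subrr; exact: cpos0.
    rewrite -lerN2 -ReN -linearN; apply: le_trans (fle _) (csup_le _).
    rewrite herm_partN herm_part_id ?star1// rmorphN1 scaleN1r subrr.
    exact: cpos0.
  by apply/eqP; rewrite eq_complex R1 f_real ?star1// !eqxx.
by exists (State f_ge0 f1).
Qed.

(** If every state kills [a], then [csup (c *: a) = 0] for all complex [c]. Using [c] and [- c], the
    Hermitian parts of [a] and of [i a] vanish. *)
Lemma exists_state_neq0 a : a <> 0 -> exists tau : state A, tau a <> 0.
Proof.
move=> a0; apply: contrapT => no; apply: a0.
have all0 (tau : state A) : tau a = 0.
  by apply: contrapT => ta; apply: no; exists tau.
have csup0 (c : R[i]) : csup (c *: a) = 0.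
  have [tau <-] := exists_state_csup (c *: a).
  by rewrite linearZ /= all0 mulr0.
have hc (c : R[i]) : herm_part (c *: a) = 0.
  by apply: csup_le0; rewrite ?csup0// -scaleNr csup0.
by apply: herm_part_eq0; rewrite // -[a]scale1r.
Qed.

Lemma exists_mean_state tau1 tau2 : exists tau : state A,
  forall a, tau a = 2^-1%:C * (tau1 a + tau2 a).
Proof.
pose f a := 2^-1%:C * (tau1 a + tau2 a).
have flin : scalar f.
  by move=> c a b; rewrite /f !linearP/=; ring.
pose F : {scalar A} := HB.pack f (GRing.isLinear.Build _ _ _ _ f flin).
have F0 a : 0 <= F (star a * a).
  by rewrite mulr_ge0 ?lecR ?invr_ge0// addr_ge0// state_ge0.
have F1 : F 1 = 1.
  rewrite /= /f !state1 -[1 + 1](rmorph_nat (real_complex R) 2) -rmorphM/=.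
  by rewrite mulVf// pnatr_eq0.
by exists (State F0 F1).
Qed.

(** States are averaged one element at a time: on [star b * b] both values are nonnegative, so their
    mean vanishes only if both do. *)
Lemma exists_common_state (s : seq A) : exists tau : state A,
  forall a, a \in s -> a <> 0 -> tau (star a * a) <> 0.
Proof.
elim: s => [|a s [tau IH]].
  have [|tau _] := @exists_state_neq0 1; first by apply/eqP; rewrite oner_eq0.
  by exists tau.
have [->|/eqP a0] := eqVneq a 0.
  by exists tau => b; rewrite inE => /predU1P[->//|]; exact: IH.
have [|tau' tau'a] := @exists_state_neq0 (star a * a).
  move=> aa0; apply: a0; apply: cnorm_eq0; apply/eqP.
  by rewrite -sqrf_eq0 -cnorm_starM aa0 cnorm0.
have [mu muE] := exists_mean_state tau tau'.
exists mu => b bs b0; rewrite muE => /eqP.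
rewrite mulf_eq0 => /orP[/eqP/complexI/eqP|]; first by rewrite invr_eq0 pnatr_eq0.
rewrite paddr_eq0 ?state_ge0// => /andP[/eqP tb /eqP t'b].
by move: bs; rewrite inE => /predU1P[ba|/IH/(_ b0)//]; apply: tau'a; rewrite -ba.
Qed.

(** A self-adjoint [h] is the difference of the positive elements [cnorm h] and [cnorm h - h], so
    its value is real; apply this to [a + star a] and [i (a - star a)]. *)
Lemma state_star tau a : tau (star a) = Num.conj (tau a).
Proof.
have pos_Im h : cpos h -> complex.Im (tau h) = 0.
  move=> /cpos_sqrt[k [[sk _] <- _]]; rewrite -{1}sk.
  by apply: ger0_Im; exact: state_ge0.
have real_Im h : star h = h -> complex.Im (tau h) = 0.
  move=> sh; have := pos_Im _ (cpos_norm_sub sh (lexx _)).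
  have := pos_Im _ (cposRA (cnorm_ge0 h)).
  rewrite linearB /=; case: (tau h) (tau _) => a1 b1 [a2 b2] /= ->.
  by rewrite sub0r => /eqP; rewrite oppr_eq0 => /eqP.
have h1 : complex.Im (tau (a + star a)) = 0.
  by apply: real_Im; rewrite starD starK addrC.
have h2 : complex.Im (tau ('i%C *: (a - star a))) = 0.
  apply: real_Im.
  by rewrite starZ starB starK conj_complexi scaleNr -scalerN opprB.
move: h1 h2; rewrite linearD linearZ linearB /=.
have -> : Num.conj (tau a) = (tau a)^*%C.
  rewrite [in LHS](complexE (tau a)) rmorphD rmorphM/= !conjRC conj_complexi.
  case: (tau a) => p q; apply/eqP; rewrite eq_complex/=.
  by apply/andP; split; apply/eqP; ring.
case: (tau a) (tau (star a)) => p q [p' q'] /= h1 h2.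
by apply/eqP; rewrite eq_complex/=; apply/andP; split; apply/eqP; lra.
Qed.

(** For unitary [w], [star (1 - w) * (1 - w) = 2 - w - star w], on which a state with [tau w = 1]
    vanishes. *)
Lemma exists_state_unitary (s : seq A) : exists tau : state A,
  forall w, w \in s -> unitary w -> w <> 1 -> tau w <> 1.
Proof.
have [tau tauP] := exists_common_state [seq 1 - w | w <- s].
exists tau => w ws [ww _] w1 tw; apply: (tauP (1 - w)).
- by apply/mapP; exists w.
- by move/subr0_eq => w1'; apply: w1.
- rewrite starB star1 mulrBl mul1r mulrBr mulr1 ww opprB.
  by rewrite linearD !linearB/= state1 state_star tw conjC1 subrr addr0.
Qed.

End States.

(** * Tensor products *)

Section MultilinearSeparation.

(** Take the least number of vectors through which the family factors; a nontrivial relation would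
    eliminate one of them. *)
Lemma free_factorization (F : fieldType) (V : lmodType F) n (x : 'I_n -> V) :
  exists r (e : 'I_r -> V) (L : 'I_n -> 'I_r -> F),
    (forall k, x k = \sum_l L k l *: e l) /\
    (forall m : 'I_r -> F, \sum_l m l *: e l = 0 -> forall l, m l = 0).
Proof.
pose P r := exists (e : 'I_r -> V) (L : 'I_n -> 'I_r -> F),
  forall k, x k = \sum_l L k l *: e l.
have Pn : exists r, `[< P r >].
  exists n; apply/asboolP; exists x, (fun k l => (k == l)%:R) => k.
  rewrite (bigD1 k)//= eqxx scale1r big1 ?addr0// => l.
  by rewrite eq_sym => /negbTE ->; rewrite scale0r.
have [r /asboolP[e [L xE]] rmin] := ex_minnP Pn.
exists r, e, L; split=> // m me0 l; apply/eqP/negPn/negP => ml.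
suff /rmin : `[< P r.-1 >].
  rewrite leqNgt prednK ?leqnn//.
  by case: l {ml} => l /=; case: r {e L xE rmin m me0}.
have eE : e l = \sum_(j < r.-1) (- ((m l)^-1 * m (lift l j))) *: e (lift l j).
  move: me0; rewrite (bigD1_ord l)//= => /eqP.
  rewrite addr_eq0 => /eqP/(congr1 (fun v => (m l)^-1 *: v)).
  rewrite scalerA mulVf// scale1r => ->; rewrite scalerN scaler_sumr -sumrN.
  by apply: eq_bigr => j _; rewrite scalerA scaleNr.
apply/asboolP; exists (fun j => e (lift l j)).
exists (fun k j => L k (lift l j) - L k l * ((m l)^-1 * m (lift l j))) => k.
rewrite xE (bigD1_ord l)//= eE scaler_sumr -big_split/=.
by apply: eq_bigr => j _; rewrite scalerA -scalerDl mulrN addrC.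
Qed.

Context {R : realType} {I : choiceType}.

Lemma dfwith_id (X : I -> Type) (x : forall i, X i) j : dfwith x j (x j) = x.
Proof. by apply: functional_extensionality_dep => i; case: dfwithP. Qed.

Lemma multilinear_linear_sum (X : I -> lmodType R[i]) (W : lmodType R[i])
    (f : (forall i, X i) -> W) (x : forall i, X i) j r (c : 'I_r -> R[i])
    (e : 'I_r -> X j) : multilinear f ->
  f (dfwith x j (\sum_l c l *: e l)) = \sum_l c l *: f (dfwith x j (e l)).
Proof.
move=> mf; pose g (y : X j) : W := f (dfwith x j y).
pose G : {linear X j -> W} := HB.pack g (GRing.isLinear.Build _ _ _ _ g (mf x j)).
rewrite -[LHS]/(G _) linear_sum; apply: eq_bigr => l _.
by rewrite linearZ.
Qed.

Lemma multilinearZ (X : I -> lmodType R[i]) (W : lmodType R[i])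
    (f : (forall i, X i) -> W) (x : forall i, X i) j (c : R[i]) (y : X j) :
  multilinear f -> f (dfwith x j (c *: y)) = c *: f (dfwith x j y).
Proof.
move=> mf; have := multilinear_linear_sum x (fun _ : 'I_1 => c) (fun=> y) mf.
by rewrite !big_ord1.
Qed.

Lemma multilinearZ_seq (X : I -> lmodType R[i]) (W : lmodType R[i])
    (f : (forall i, X i) -> W) (c : I -> R[i]) (s : seq I) (x y : forall i, X i) :
  multilinear f -> uniq s -> (forall i, i \notin s -> y i = x i) ->
  (forall i, i \in s -> y i = c i *: x i) ->
  f y = (\prod_(i <- s) c i) *: f x.
Proof.
move=> mf; elim: s y => [|j s IH] y /=.
  move=> _ yx _; rewrite big_nil scale1r; congr f.
  by apply: functional_extensionality_dep => i; exact: yx.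
move=> /andP[js us] yx ycx; rewrite big_cons -scalerA -(IH (dfwith y j (x j)))//.
- rewrite -multilinearZ// -ycx ?mem_head//; congr f.
  by apply: functional_extensionality_dep => i; do 2?case: dfwithP.
- move=> i; case: dfwithP => // {}i ji is_; apply: yx.
  by rewrite inE negb_or eq_sym ji.
- move=> i; case: dfwithP => [|{}i ji is_]; first by rewrite (negbTE js).
  by apply: ycx; rewrite inE is_ orbT.
Qed.

(* Expanding the [j]-th components over linearly independent vectors reduces
   the claim to one with fewer varying components. *)
Lemma multilinear_sum_eq0 (X : I -> lmodType R[i]) (W : lmodType R[i])
    (f : (forall i, X i) -> W) (D : I -> Type)
    (ev : forall i, D i -> {scalar X i}) (d0 : forall i, D i) :
  multilinear f ->
  (forall i (v : X i), (forall d, ev i d v = 0) -> v = 0) ->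
  forall (s : seq I) n (c : 'I_n -> R[i]) (a : 'I_n -> forall i, X i)
    (b : forall i, X i), uniq s ->
  (forall k i, i \notin s -> a k i = b i) ->
  (forall d : forall i, D i,
    \sum_k c k * \prod_(i <- s) ev i (d i) (a k i) = 0) ->
  \sum_k c k *: f (a k) = 0.
Proof.
move=> mf sep; elim=> [|j s IH] n c a b /=.
  (* With no index left, all [a k] equal [b], and the hypothesis at [d0] says that the coefficients
     add up to 0. *)
  move=> _ ab /(_ d0); under eq_bigr do rewrite big_nil mulr1.
  move=> c0; under eq_bigr => k _.
    have -> : a k = b by apply: functional_extensionality_dep => i; exact: ab.
    over.
  by rewrite -scaler_suml c0 scale0r.
move=> /andP[js us] ab hd.
have [r [e [L [aE efree]]]] := free_factorization (fun k => a k j).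
have ev_out d (k : 'I_n) (y : X j) : \prod_(i <- s) ev i (d i) (dfwith (a k) j y i) =
    \prod_(i <- s) ev i (d i) (a k i).
  apply: eq_big_seq => i is_; rewrite dfwithout//.
  by apply: contraNneq js => ->.
have term0 l : \sum_k (c k * L k l) *: f (dfwith (a k) j (e l)) = 0.
  apply: (IH _ _ _ (dfwith b j (e l)) us) => [k i|d].
    case: dfwithP => [|{}i ji is_]; first by rewrite dfwithin.
    by rewrite dfwithout// ab// inE negb_or eq_sym ji.
  under eq_bigr do rewrite ev_out mulrAC.
  (* By independence it suffices that the combination of the [a k j], weighted by the evaluations
     over [s], vanishes. Every functional at [j] kills it, by the hypothesis on [j :: s]. *)
  apply: (efree (fun l => \sum_k c k * (\prod_(i <- s) ev i (d i) (a k i)) * L k l)).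
  under eq_bigr do rewrite scaler_suml.
  rewrite exchange_big/=; apply: sep => d1.
  rewrite -[RHS](hd (dfwith d j d1)) linear_sum; apply: eq_bigr => k _.
  under eq_bigr do rewrite -scalerA.
  rewrite -scaler_sumr -aE linearZ/= big_cons dfwithin -mulrA; congr (_ * _).
  rewrite mulrC; congr (_ * _); apply: eq_big_seq => i is_.
  by rewrite dfwithout//; apply: contraNneq js => ->.
transitivity (\sum_k \sum_l (c k * L k l) *: f (dfwith (a k) j (e l))).
  apply: eq_bigr => k _; rewrite -[in LHS](dfwith_id (a k) j) aE.
  rewrite multilinear_linear_sum// scaler_sumr.
  by apply: eq_bigr => l _; rewrite scalerA.
by rewrite exchange_big big1.
Qed.

End MultilinearSeparation.

(** * Inner products of elementary tensors *)

Section Phi1.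
Context {R : realType} {I : choiceType} {H : I -> hilbertType R}.
Implicit Types (x y : forall i, H i).

Lemma inner_unit (K : hilbertType R) (v : K) : `|v| = 1 -> inner v v = 1.
Proof. by move=> v1; rewrite -inner_norm v1 expr1n. Qed.

Lemma norm_unit (K : hilbertType R) (v : K) : inner v v = 1 -> `|v| = 1.
Proof.
by rewrite -inner_norm => /eqP; rewrite pexpr_eq1// => /eqP.
Qed.

Lemma phi1_inner_seq x y (s : seq I) : uniq s ->
  (forall i, i \notin s -> inner (x i) (y i) = 1) ->
  phi1_inner x y = \prod_(i <- s) inner (x i) (y i).
Proof.
move=> us out; rewrite /phi1_inner asboolT.
  rewrite (@fsbigE _ _ _ _ _ s)//; last by move=> i _; exact: out.
  by apply: eq_bigl => i; rewrite in_setT.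
apply: (@sub_finite_set _ _ [set` s]); last exact: finite_seq.
by move=> i /= xy; apply: contrapT => /negP/out.
Qed.

Context {K : phi1Tensor H}.

Lemma phi1_elem_un x : sphere_family x -> tensor_un (tmap (phi1_tensor K) x).
Proof.
move=> sx; exists 1%N, (fun=> 1), (fun=> tmap _ x).
split; first by move=> _; exists x.
by rewrite big_ord1 scale1r.
Qed.

Lemma phi1_embZ (c : R[i]) t : tensor_un t ->
  @phi1_emb _ _ _ K (c *: t) = c *: phi1_emb t.
Proof.
move=> ut; have u0 : tensor_un (0 : phi1_tensor K).
  by exists 0%N, (fun=> 0), (fun=> 0); split; [case|rewrite big_ord0].
have e0 : @phi1_emb _ _ _ K 0 = 0.
  have := phi1_emb_linear 1 u0 u0; rewrite !scale1r addr0 => /eqP.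
  by rewrite -subr_eq0 opprD addNKr oppr_eq0 => /eqP.
by have := phi1_emb_linear c ut u0; rewrite e0 !addr0.
Qed.

(** The inner product is prescribed for families of unit vectors only, so the components of [x] over
    [s] are normalized and their scalars pulled out by multilinearity. *)
Lemma phi1_inner_elem x y (s : seq I) : uniq s -> sphere_family y ->
  (forall i, i \notin s -> `|x i| = 1) ->
  exists (c : I -> R[i]) x', [/\ sphere_family x',
    forall i, x i = c i *: x' i, forall i, i \notin s -> x' i = x i &
    inner (phi1_elem K x) (phi1_elem K y) =
      \prod_(i <- s) c i * phi1_inner x' y].
Proof.
move=> us sy x1.
have hx i : exists cv : R[i] * H i, [/\ `|cv.2| = 1, x i = cv.1 *: cv.2 &
    i \notin s -> cv.2 = x i].
  have [is_|is_] := boolP (i \in s); last by exists (1, x i); rewrite scale1r x1.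
  have [xi0|xi0] := eqVneq (x i) 0.
    (* A zero component has no direction: the unit vector [y i] stands in, with coefficient 0. *)
    by exists (0, y i); rewrite scale0r sy.
  exists (`|x i|, `|x i|^-1 *: x i); split=> //=.
    by rewrite normrZ normfV normr_id mulVf// normr_eq0.
  by rewrite scalerA mulfV ?scale1r// normr_eq0.
pose cv i := sval (cid (hx i)).
have cvP i : [/\ `|(cv i).2| = 1, x i = (cv i).1 *: (cv i).2 &
    i \notin s -> (cv i).2 = x i] := svalP (cid (hx i)).
exists (fun i => (cv i).1), (fun i => (cv i).2).
have sx' : sphere_family (fun i => (cv i).2) by move=> i; case: (cvP i).
split=> //; [by move=> i; case: (cvP i)|by move=> i; case: (cvP i)|].
rewrite -(phi1_emb_inner K)// /phi1_elem.
rewrite (@multilinearZ_seq _ _ _ _ (tmap (phi1_tensor K))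
  (fun i => (cv i).1) s (fun i => (cv i).2) x)//.
- by rewrite phi1_embZ ?linearZl_LR//; exact: phi1_elem_un.
- by case: (tmapP (phi1_tensor K)).
- by move=> i; case: (cvP i) => _ _ h /h.
- by move=> i _; case: (cvP i).
Qed.

Lemma phi1_inner_elem_eq x y (s : seq I) : uniq s -> sphere_family y ->
  (forall i, i \notin s -> x i = y i) ->
  inner (phi1_elem K x) (phi1_elem K y) = \prod_(i <- s) inner (x i) (y i).
Proof.
move=> us sy xy.
have [|c [x' [sx' xE x'x ->]]] := @phi1_inner_elem x y s us sy.
  by move=> i /xy ->; exact: sy.
rewrite (phi1_inner_seq us) -?big_split/=; last first.
  by move=> i is_; rewrite x'x// xy// inner_unit.
by apply: eq_bigr => i _; rewrite xE linearZl_LR.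
Qed.

(** Normalizing alters components over [s] only, so infinitely many factors still differ from 1 and
    [phi1_inner] takes its default value 0. *)
Lemma phi1_inner_elem_neq x y (s : seq I) : uniq s -> sphere_family y ->
  (forall i, i \notin s -> `|x i| = 1) ->
  ~ finite_set [set i | inner (x i) (y i) <> 1] ->
  inner (phi1_elem K x) (phi1_elem K y) = 0.
Proof.
move=> us sy x1 inf.
have [c [x' [sx' _ x'x ->]]] := phi1_inner_elem us sy x1.
rewrite /phi1_inner asboolF ?mulr0// => fin; apply: inf.
apply: (@sub_finite_set _ _ ([set i | inner (x' i) (y i) <> 1] `|` [set` s])).
  move=> i /= xy; have [is_|is_] := boolP (i \in s); first by right.
  by left; rewrite x'x.
by rewrite finite_setU; split => //; exact: finite_seq.
Qed.

End Phi1.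

(** * Linear spans, sums of elementary tensors, and cofinite agreement *)

Section LinearSpanTheory.
Context {R : realType} {V : lmodType R[i]}.
Implicit Types (E F : set V) (x y : V).

Lemma lspan0 E : lspan E 0.
Proof. by exists 0%N, (fun=> 0), (fun=> 0); split; [case|rewrite big_ord0]. Qed.

Lemma lspan_gen E x : E x -> lspan E x.
Proof.
by exists 1%N, (fun=> 1), (fun=> x); split=> //; rewrite big_ord1 scale1r.
Qed.

Lemma lspanP E (c : R[i]) x y : lspan E x -> lspan E y -> lspan E (c *: x + y).
Proof.
move=> [m [a [u [Eu ->]]]] [n [b [v [Ev ->]]]].
exists (m + n)%N, (fun k =>
  match fintype.split k with inl i => c * a i | inr j => b j end).
exists (fun k => match fintype.split k with inl i => u i | inr j => v j end).
split; first by move=> k; case: (fintype.split k).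
rewrite big_split_ord scaler_sumr/=; congr (_ + _); apply: eq_bigr => k _.
  by rewrite (unsplitK (inl k)) scalerA.
by rewrite (unsplitK (inr k)).
Qed.

Lemma lspan_sum E n (c : 'I_n -> R[i]) (x : 'I_n -> V) :
  (forall k, lspan E (x k)) -> lspan E (\sum_k c k *: x k).
Proof.
move=> Ex; apply: (big_ind (lspan E)).
- exact: lspan0.
- by move=> y z Ey Ez; rewrite -[y]scale1r; exact: lspanP.
- by move=> k _; rewrite -[_ *: _]addr0; apply: lspanP => //; exact: lspan0.
Qed.

Lemma lspan_sub E F : E `<=` lspan F -> lspan E `<=` lspan F.
Proof.
by move=> EF _ [n [c [x [Ex ->]]]]; apply: lspan_sum => k; exact: EF.
Qed.

End LinearSpanTheory.

Section TensorUt.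
Context {R : realType} {I : choiceType} {A : I -> starAlgType R}
  {T : tensorAlgebra A}.

Lemma tensor_ut_gen (a u : forall i, A i) : (forall i, unitary (u i)) ->
  cofin_eq a u -> tensor_ut (tamap T a).
Proof.
by move=> uu au; apply: lspan_gen; exists u => //; apply: lspan_gen; exists a.
Qed.

Lemma unitary1 (B : starAlgType R) : unitary (1 : B).
Proof. by rewrite /unitary/= star1 mulr1. Qed.

Lemma tensor_ut1 : tensor_ut (1 : T).
Proof.
rewrite -tamap1; apply: (@tensor_ut_gen _ (fun=> 1)) => [i|].
  exact: unitary1.
by apply: (@sub_finite_set _ _ set0); [move=> i /=; apply|exact: finite_set0].
Qed.

Lemma tensor_ut_sum (x : T) : tensor_ut x ->
  exists n (c : 'I_n -> R[i]) (a u : 'I_n -> forall i, A i),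
    (forall k, (forall i, unitary (u k i)) /\ cofin_eq (a k) (u k)) /\
    x = \sum_k c k *: tamap T (a k).
Proof.
pose E := [set tamap T a | a in [set a | exists u : forall i, A i,
  (forall i, unitary (u i)) /\ cofin_eq a u]].
move=> Tx; have : lspan E x.
  apply: lspan_sub Tx => y [u uu]; apply: lspan_sub => _ [a au <-].
  by apply: lspan_gen; exists a => //; exists u.
move=> [n [c [z [Ez ->]]]].
have {Ez} h k : exists au : (forall i, A i) * (forall i, A i),
    [/\ forall i, unitary (au.2 i), cofin_eq au.1 au.2 & tamap T au.1 = z k].
  by have [a [u [uu au]] <-] := Ez k; exists (a, u).
have [au auP] := choice h.
exists n, c, (fun k => (au k).1), (fun k => (au k).2); split.
  by move=> k; case: (auP k).
by apply: eq_bigr => k _; case: (auP k) => _ _ ->.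
Qed.

End TensorUt.

Lemma star_rep0 (R : realType) (B : starAlgType R) (D : set B)
    (H : hilbertType R) (rho : B -> H -> H) (x : H) :
  D 0 -> star_rep D rho -> rho 0 x = 0.
Proof.
move=> D0 [_ lin _ _ _]; have := lin 1 0 0 x D0 D0.
rewrite !scale1r addr0 => /eqP.
by rewrite -subr_eq0 opprD addNKr oppr_eq0 => /eqP.
Qed.

(** Linearity in the algebra element is granted on the span only, so membership of the partial sums
    is carried through the induction. *)
Lemma star_rep_sum (R : realType) (B : starAlgType R) (E : set B)
    (H : hilbertType R) (rho : B -> H -> H) n (c : 'I_n -> R[i])
    (a : 'I_n -> B) (x : H) : star_rep (lspan E) rho ->
  (forall k, lspan E (a k)) ->
  rho (\sum_k c k *: a k) x = \sum_k c k *: rho (a k) x.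
Proof.
move=> rep Ea; have r0 := star_rep0 x (lspan0 E) rep.
have [_ lin _ _ _] := rep.
suff [] : lspan E (\sum_k c k *: a k) /\
  rho (\sum_k c k *: a k) x = \sum_k c k *: rho (a k) x by [].
apply: (big_rec2 (fun y z => lspan E y /\ rho y x = z)).
  by split; [exact: lspan0|].
move=> k y z _ [Ey <-]; split; first exact: lspanP.
by rewrite lin.
Qed.

Section CofinEq.
Context {I : choiceType} {X : I -> Type}.
Implicit Types u v w : forall i, X i.

Lemma cofin_eq_refl u : cofin_eq u u.
Proof.
apply: (@sub_finite_set _ _ set0); last exact: finite_set0.
by move=> i /=; apply.
Qed.

Lemma cofin_eq_sym u v : cofin_eq u v -> cofin_eq v u.
Proof. by apply: sub_finite_set => i /= uv vu; apply: uv. Qed.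

Lemma cofin_eq_trans v u w : cofin_eq u v -> cofin_eq v w -> cofin_eq u w.
Proof.
move=> uv vw.
apply: (@sub_finite_set _ _ ([set i | u i <> v i] `|` [set i | v i <> w i])).
  move=> i /= uw; have [uvi|] := pselect (u i = v i); last by left.
  by right; rewrite -uvi.
by rewrite finite_setU.
Qed.

Lemma cofin_eq_seq u v : cofin_eq u v ->
  exists s : seq I, forall i, i \notin s -> u i = v i.
Proof.
move=> /finite_seqP[s sE]; exists s => i is_; apply: contrapT => uv.
by move/negP: is_; apply; change ([set` s] i); rewrite -sE.
Qed.

End CofinEq.

(** * Vanishing of elements killed by all product states *)

Section Faithful.
Context {R : realType} {I : choiceType} {A : I -> cstarAlgType R}.
Context {T : tensorAlgebra (fun i => A i : starAlgType R)}.
Context (gns : forall (i : I) (tau : state (A i)), gnsTriple tau).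
Context {K : forall rho : (forall i, state (A i)),
  phi1Tensor (fun i => gns_space (@gns i (rho i)))}.
Context {Pi : forall rho : (forall i, state (A i)), T -> K rho -> K rho}.
Context (PiP : forall rho : (forall i, state (A i)),
  is_phi1_rep (fun i => @gns_rep R (A i) (rho i) (@gns i (rho i))) (@Pi rho)).

Lemma sphere_gns_class (rho : forall i, state (A i)) (u : forall i, A i) i :
  unitary (u i) -> `|gns_class (@gns i (rho i)) (u i)| = 1.
Proof.
by move=> [uu _]; apply: norm_unit; rewrite gns_inner uu state1.
Qed.

Let xi rho : K rho := phi1_elem (K rho) (fun i => gns_vec (@gns i (rho i))).

(** The cyclic vectors are the classes of 1, so an elementary tensor sends their tensor to the
    tensor of the classes of its components. *)
Lemma inner_phi1_rep (rho : forall i, state (A i)) n (c : 'I_n -> R[i])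
    (a u : 'I_n -> forall i, A i) (v : K rho) :
  (forall k, (forall i, unitary (u k i)) /\ cofin_eq (a k) (u k)) ->
  inner (@Pi rho (\sum_k c k *: tamap T (a k)) (xi rho)) v =
  \sum_k c k * inner (phi1_elem (K rho)
    (fun i => gns_class (@gns i (rho i)) (a k i))) v.
Proof.
move=> auP; have [repP Pi_elem] := PiP rho.
have Ta k : tensor_ut (tamap T (a k)).
  by have [uu au] := auP k; exact: tensor_ut_gen uu au.
rewrite (star_rep_sum _ _ repP)// linear_sumlz; apply: eq_bigr => k _.
rewrite linearZl_LR; congr (_ * _); rewrite Pi_elem//; last first.
  apply: phi1_elem_un => i; rewrite gns_vecE.
  by apply: (sphere_gns_class rho (u := fun=> 1)); exact: unitary1.
congr (inner (phi1_elem (K rho) _) v); apply: functional_extensionality_dep => i.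
by rewrite gns_vecE gns_repE mulr1.
Qed.

Lemma class_component_eq0 n (c : 'I_n -> R[i]) (a u : 'I_n -> forall i, A i)
    (k0 : 'I_n) :
  (forall k, (forall i, unitary (u k i)) /\ cofin_eq (a k) (u k)) ->
  (forall rho, @Pi rho (\sum_k c k *: tamap T (a k)) (xi rho) = 0) ->
  \sum_(k | `[< cofin_eq (u k) (u k0) >]) c k *: tamap T (a k) = 0.
Proof.
move=> auP Pi0; set S := fun k => `[< cofin_eq (u k) (u k0) >].
pose v := u k0; have uv i : unitary (v i) by case: (auP k0).
have /choice[s_ s_P] : forall k, exists s : seq I, forall i, i \notin s ->
    a k i = u k i /\ (S k -> a k i = v i).
  move=> k; have [_ /cofin_eq_seq[s1 s1P]] := auP k.
  have [/asboolP/cofin_eq_seq[s2 s2P]|nS] := boolP (S k).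
    exists (s1 ++ s2) => i; rewrite mem_cat negb_or => /andP[/s1P -> /s2P ->].
    by [].
  by exists s1 => i /s1P ->.
(* Finitely many exceptional indices for all terms together. *)
pose s := undup (flatten [seq s_ k | k <- enum 'I_n]).
have us : uniq s by exact: undup_uniq.
have sP k i : i \notin s -> a k i = u k i /\ (S k -> a k i = v i).
  move=> is_; apply: s_P; apply: contra is_ => is_; rewrite mem_undup.
  by apply/flatten_mapP; exists k => //; rewrite mem_enum.
have generic i : exists tau : state (A i), forall k,
    star (v i) * u k i <> 1 -> tau (star (v i) * u k i) <> 1.
  have [tau tauP] := exists_state_unitary [seq star (v i) * u k i | k <- enum 'I_n].
  exists tau => k; apply: tauP.
    by apply/mapP; exists k => //; rewrite mem_enum.
  have [[uu1 uu2] [vv1 vv2]] := ((auP k).1 i, uv i).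
  split; rewrite /= starM starK.
    by rewrite mulrA -[_ * v i * _]mulrA vv2 mulr1.
  by rewrite mulrA -[_ * u k i * _]mulrA uu2 mulr1.
pose rho0 i := sval (cid (generic i)).
have rho0P i k : star (v i) * u k i <> 1 -> rho0 i (star (v i) * u k i) <> 1.
  exact: (svalP (cid (generic i)) k).
(* This is the inner product of the GNS classes of [x] and [v i]. Such functionals still separate
   points because [v i] is invertible. *)
pose evf i (d : state (A i)) (x : A i) : R[i] := d (star (v i) * x).
have evlin i d : scalar (@evf i d).
  by move=> t x y; rewrite /evf mulrDr -scalerAr linearP.
pose ev i d : {scalar A i} := HB.pack (@evf i d)
  (GRing.isLinear.Build _ _ _ _ (@evf i d) (evlin i d)).
(* Terms outside the class get coefficient 0 and the family [v], so that all families agree off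
   [s]. *)
pose a' k := if S k then a k else v.
rewrite big_mkcond/=.
have -> : \sum_k (if S k then c k *: tamap T (a k) else 0) =
    \sum_k (if S k then c k else 0) *: tamap T (a' k).
  by apply: eq_bigr => k _; rewrite /a'; case: ifP => // _; rewrite scale0r.
apply: (multilinear_sum_eq0 (ev := ev) rho0 _ _ (s := s) (b := v)) => //.
- by case: (tamapP T).
- move=> i x x0; have vx0 : star (v i) * x = 0.
    apply: contrapT => /exists_state_neq0[tau]; apply.
    exact: x0.
  have [_ vv] := uv i.
  by rewrite -[x]mul1r -vv -mulrA vx0 mulr0.
- move=> k i is_; rewrite /a'; case: ifP => // Sk.
  by case: (sP k i is_) => _ /(_ Sk).
- move=> d; pose rho i := if i \in s then d i else rho0 i.
  pose y i := gns_class (@gns i (rho i)) (v i).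
  have sy : sphere_family y by move=> i; exact: sphere_gns_class.
  have := @inner_phi1_rep rho n c a u (phi1_elem (K rho) y) auP.
  rewrite Pi0 linear0l => sum0; rewrite [RHS]sum0; apply: eq_bigr => k _.
  rewrite /a'; have [Sk|nSk] := boolP (S k).
    rewrite (phi1_inner_elem_eq us)//; last first.
      by move=> i is_; case: (sP k i is_) => _ ->.
    congr (_ * _); apply: eq_big_seq => i is_.
    by rewrite gns_inner /= /rho is_.
  rewrite mul0r (phi1_inner_elem_neq us)// ?mulr0//.
    move=> i is_; case: (sP k i is_) => -> _.
    by apply: sphere_gns_class; case: (auP k).
  (* Off [s], the choice of [rho0] makes the factor differ from 1 wherever [u k i] differs from
     [v i]; finitely many such factors would put [k] in the class. *)
  move=> fin; move/negP: nSk; apply; apply/asboolP.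
  apply: (@sub_finite_set _ _ ([set i |
      inner (gns_class (@gns i (rho i)) (a k i)) (y i) <> 1] `|` [set` s])).
    move=> i /= uvi; have [is_|is_] := boolP (i \in s); [by right|left].
    rewrite gns_inner; case: (sP k i is_) => -> _.
    rewrite /rho (negbTE is_); apply: rho0P => vu1; apply: uvi.
    have [_ vv] := uv i.
    by rewrite -[u k i]mul1r -vv -mulrA vu1 mulr1.
  by rewrite finite_setU; split => //; exact: finite_seq.
Qed.

Lemma tensor_ut_eq0 (x : T) : tensor_ut x ->
  (forall rho, @Pi rho x (xi rho) = 0) -> x = 0.
Proof.
move=> /tensor_ut_sum[n [c [a [u [auP ->]]]]] Pi0.
pose e k l := `[< cofin_eq (u k) (u l) >].
(* A representative of the class of [k]: equivalent indices define the same predicate, hence the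
   same pick, and the sum splits along the values of [r]. *)
pose r k := odflt k [pick l | e l k].
have e_refl k : e k k by apply/asboolP; exact: cofin_eq_refl.
have re k : e (r k) k by rewrite /r; case: pickP.
have rE k l : (r k == r l) = e k l.
  apply/idP/idP => [/eqP rkl|/asboolP kl].
    apply/asboolP; move/asboolP: (re k).
    rewrite rkl => /cofin_eq_sym/cofin_eq_trans; apply.
    exact/asboolP/re.
  have kl_pick : (fun j => e j k) =1 (fun j => e j l).
    move=> j; apply/asboolP/asboolP => /cofin_eq_trans; apply => //.
    exact: cofin_eq_sym.
  rewrite /r (eq_pick kl_pick); case: pickP => // /(_ l).
  by rewrite e_refl.
rewrite (partition_big r xpredT)//= big1// => j _.
have [[k0 <-]|nj] := pselect (exists k0, r k0 = j).
  under eq_bigl do rewrite rE; exact: class_component_eq0.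
by rewrite big1// => k /eqP rk; exfalso; apply: nj; exists k.
Qed.

End Faithful.

(** * Direct sums and injectivity *)

Lemma l2sum_single (R : realType) (P : Type) (H : P -> hilbertType R)
    (M : forall p, set (H p)) (p0 : P) (v : H p0) :
  (forall p, M p 0) -> M p0 v -> exists x : {x : forall p, H p | l2sum M x},
    sval x p0 = v.
Proof.
move=> M0 Mv.
pose x (p : P) : H p := dfwith (I := {classic P}) (fun p => 0 : H p) p0 v p.
have xp0 : x p0 = v by rewrite /x dfwithin.
suff lx : l2sum M x by exists (exist _ x lx).
split.
  move=> p; rewrite /x.
  by case: (@dfwithP {classic P} (fun p => H p) (fun p => 0) p0 v p).
have -> : \esum_(p in [set: {classic P}]) (complex.Re (inner (x p) (x p)))%:E =
    \esum_(p in [set: {classic P}])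
      (if p \in [set (p0 : {classic P})]
       then (complex.Re (inner (x p) (x p)))%:E else 0).
  apply: eq_esum => p _; case: ifPn => // /negP pp0.
  rewrite /x dfwithout ?linear0l//.
  by apply/eqP => p0p; apply: pp0; rewrite inE/=.
rewrite -esum_mkcond esum_set1 ?ltry// lee_fin.
have : 0 <= inner (x p0) (x p0) by rewrite -inner_norm exprn_ge0.
by rewrite lecE => /andP[_].
Qed.

Theorem corollary5p9 (R : realType) (I : choiceType)
    (infI : infinite_set [set: I]) (A : I -> cstarAlgType R)
    (T : tensorAlgebra (fun i => A i : starAlgType R))
    (gns : forall (i : I) (tau : state (A i)), gnsTriple tau)
    (K : forall rho : (forall i, state (A i)),
       phi1Tensor (fun i => gns_space (gns i (rho i))))
    (Pi : forall rho : (forall i, state (A i)), T -> K rho -> K rho)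
    (PiP : forall rho : (forall i, state (A i)),
       is_phi1_rep (fun i => @gns_rep R (A i) (rho i) (gns i (rho i)))
         (Pi rho)) :
  let Hcheck rho : set (K rho) :=
    orbit_closure (tensor_ut (T := T)) (Pi rho)
      (phi1_elem (K rho) (fun i => gns_vec (gns i (rho i)))) in
  let Psi := dsum_rep (M := Hcheck) Pi in
  let Phi := dsum_rep (M := fun rho => [set: K rho]) Pi in
  set_inj (tensor_ut (T := T)) Psi /\ set_inj (tensor_ut (T := T)) Phi.
Proof.
move=> Hcheck Psi Phi.
pose xi rho : K rho := phi1_elem (K rho) (fun i => gns_vec (gns i (rho i))).
(* Both claims reduce to subspaces containing 0 and the product vector [xi rho]. The orbit closure
   contains them as the images of [xi rho] under the algebra elements 0 and 1. *)
suff inj (M : forall rho, set (K rho)) : (forall rho, M rho 0) ->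
    (forall rho, M rho (xi rho)) ->
    set_inj (tensor_ut (T := T)) (dsum_rep (M := M) Pi).
  split; apply: inj => // rho; apply: subset_closure.
    exists 0; first exact: lspan0.
    by have [rep _] := PiP rho; exact: star_rep0 (lspan0 _) rep.
  exists 1; first exact: tensor_ut1.
  by have [[_ _ _ ->]] := PiP rho.
move=> M0 Mxi a b /set_mem Ta /set_mem Tb ab.
apply/eqP; rewrite -subr_eq0 -[b]scale1r -scaleNr addrC; apply/eqP.
apply: (tensor_ut_eq0 PiP) => [|rho]; first exact: lspanP.
(* Evaluating both operators at the vector concentrated at [rho] with value [xi rho] shows that
   [a - b] annihilates [xi rho]. *)
have [x xE] := l2sum_single M0 (Mxi rho).
have := congr1 (fun f => f x rho) ab; rewrite /dsum_rep xE => abE.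
have [[_ lin _ _ _] _] := PiP rho.
by rewrite lin// -/(xi rho) abE scaleN1r addNr.
Qed.
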